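(* In the setting described in the context, let $u,v,w,f\in C_0(E)\cap D(\mathcal{E})$. Then (i) $d\mu^c_{\langle uv,w\rangle}=u\,d\mu^c_{\langle v,w\rangle}+v\,d\mu^c_{\langle u,w\rangle}$; (ii) $\langle L(u,vw),f\rangle=\langle L(u,v),wf\rangle$; (iii) $\langle L(uv,w),f\rangle=\langle L(u,w),vf\rangle+\langle L(v,w),uf\rangle$.
   Context: $E$ is a locally compact separable metric space with metric $\rho$, $m$ a positive Radon measure on $E$ with $\mathrm{supp}[m]=E$, $(\cdot,\cdot)$ the inner product of $L^2(E;m)$, $d$ the diagonal of $E\times E$, and $(\mathcal{E},D(\mathcal{E}))$ a regular semi-Dirichlet form on $L^2(E;m)$ with co-resolvent $(\hat G_\beta)$. Standing assumption: for $f,g\in C_0(E)\cap D(\mathcal{E})$, $fg\in C_0(E)\cap D(\mathcal{E})$ and $(f(y)-f(x))g(y)$ is $J$-integrable. $J$ (positive Radon on $E\times E\setminus d$) and $K$ (positive Radon on $E$) are the jumping and killing measures: the unique measures with $\mathcal{E}(u,v)=\int_{E\times E\setminus d}2(u(y)-u(x))v(y)J(dxdy)+\int_E uv\,dK$ whenever $v\in C_0(E)\cap D(\mathcal{E})$ and $u\in C_0(E)\cap D(\mathcal{E})$ is constant on a neighbourhood of $\mathrm{supp}[v]$. $\hat\sigma_\beta$ is the positive Radon measure on $E\times E$ with $(\beta\hat G_\beta u,v)=\int u(x)v(y)\hat\sigma_\beta(dxdy)$. Fix relatively compact open $\Omega_l\uparrow E$, $\varsigma_l\downarrow0$ with $\{(x,y)\in\Omega_l^2:\rho(x,y)\ge\varsigma_l\}$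 a $J$-continuity set, and $\Lambda_l:=\{(x,y)\in\Omega_l^2:\rho(x,y)<\varsigma_l\}$. For $u,v\in C_0(E)\cap D(\mathcal{E})$: $\mathcal{E}^c(u,v):=\mathcal{E}(u,v)-\int_{E\times E\setminus d}2(u(y)-u(x))v(y)J(dxdy)-\int_E uv\,dK$; $\hat{\mathcal{E}}^c(u,v):=\lim_l\lim_{\beta\to\infty}\beta\int_{\Lambda_l}(u(y)-u(x))v(y)\hat\sigma_\beta(dxdy)$ (the limit exists); $\mu^c_{\langle u,v\rangle}$ is the unique signed Radon measure on $E$ with $\int_E f\,d\mu^c_{\langle u,v\rangle}=\mathcal{E}^c(u,vf)+\mathcal{E}^c(v,uf)-\mathcal{E}^c(uv,f)$ for all $f\in C_0(E)\cap D(\mathcal{E})$; $\langle L(u,v),f\rangle:=\frac12(\mathcal{E}^c(u,vf)-\hat{\mathcal{E}}^c(u,vf))$ for $f\in C_0(E)\cap D(\mathcal{E})$. *)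

(* Defs.v *)
From HB Require Import structures.
From mathcomp Require Import all_boot all_order all_algebra.
From mathcomp Require Import all_classical all_reals all_analysis.
Set Implicit Arguments. Unset Strict Implicit. Unset Printing Implicit Defensive.
Import Order.TTheory GRing.Theory Num.Theory.
Import numFieldNormedType.Exports.
Local Open Scope classical_set_scope.
Local Open Scope ring_scope.

(* metric spaces with a distinguished point (MathComp-Analysis measurable
   types are required to be pointed, i.e. nonempty) *)
#[short(type="pmetricType")]
HB.structure Definition PMetric (K : numDomainType) :=
  { M of Pointed M & Metric K M }.

Notation borel T := (g_sigma_algebraType (@open T)).

Section Setting.
Context {R : realType} {E : pmetricType R}.

Local Notation BE := (borel E).
Local Notation BEE := (borel (E * E)%type).

Definition rho : E -> E -> R := @mdist R E.

Definition diagE : set (E * E) := [set p | p.1 = p.2].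

Definition supp (f : E -> R) : set E := closure [set x | f x != 0].

Definition C0 : set (E -> R) := [set f | continuous f /\ compact (supp f)].

Definition separable_space : Prop :=
  exists S : set E, countable S /\ dense S.

(* positive Radon measure on E (locally compact separable metric):
   Borel measure finite on compact sets *)
Definition radonE (mu : {measure set BE -> \bar R}) : Prop :=
  forall C : set E, compact C -> (mu C < +oo)%E.

Definition radonEE (mu : {measure set BEE -> \bar R}) : Prop :=
  forall C : set (E * E), compact C -> (mu C < +oo)%E.

(* positive Radon measure on E x E \ d, seen as a measure on E x E
   not charging d *)
Definition radon_offdiag (mu : {measure set BEE -> \bar R}) : Prop :=
  mu diagE = 0%E /\
  forall C : set (E * E), compact C -> C `<=` ~` diagE -> (mu C < +oo)%E.

Definition full_support (mu : {measure set BE -> \bar R}) : Prop :=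
  forall O : set E, open O -> O !=set0 -> (0 < mu O)%E.

Variable m : {measure set BE -> \bar R}.

Definition L2 : set (E -> R) :=
  [set f | measurable_fun [set: BE] (f : BE -> R) /\
           m.-integrable [set: BE] (fun x => (f x ^+ 2)%:E)].

Definition inner (f g : E -> R) : R := \int[m]_(x in [set: BE]) (f x * g x).

Definition aeeq (f g : E -> R) : Prop := {ae m, forall x : BE, f x = g x}.

Variables (D : set (E -> R)) (F : (E -> R) -> (E -> R) -> R).

Definition Falpha (a : R) (u v : E -> R) : R := F u v + a * inner u v.

(* (E, D(E)) is a semi-Dirichlet form on L^2(E;m); elements of L^2 are
   represented by functions, D is saturated under m-a.e. equality and
   F does not depend on the chosen representatives *)
Definition semi_dirichlet_form : Prop :=
  [/\ D `<=` L2 /\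
      (forall u u', D u -> L2 u' -> aeeq u u' ->
         D u' /\ forall v, D v -> F u v = F u' v /\ F v u = F v u'),
      (D 0 /\ forall (a : R) u v, D u -> D v -> D (a *: u + v)),
      (forall (a : R) u v w, D u -> D v -> D w ->
         F (a *: u + v) w = a * F u w + F v w /\
         F w (a *: u + v) = a * F w u + F w v),
      (forall f, L2 f -> forall eps : R, 0 < eps ->
         exists2 u, D u & inner (f - u) (f - u) < eps) &
    [/\
        (forall u, D u -> 0 <= F u u),
        (exists2 Ks : R, 0 < Ks & forall u v, D u -> D v ->
           `|Falpha 1 u v| <= Ks * Num.sqrt (Falpha 1 u u)
                                 * Num.sqrt (Falpha 1 v v)),
        (forall un : nat -> E -> R, (forall n, D (un n)) ->
           (forall eps : R, 0 < eps -> exists N, forall n k, (N <= n)%N ->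
              (N <= k)%N -> Falpha 1 (un n - un k) (un n - un k) < eps) ->
           exists2 u, D u &
             (fun n => Falpha 1 (un n - u) (un n - u)) @ \oo --> (0 : R)) &
        (forall u, D u ->
           let v := fun x => Num.min (Num.max (u x) 0) 1 in
           D v /\ 0 <= F (u + v) (u - v))]].

Definition regular_form : Prop :=
  (forall u, D u -> forall eps : R, 0 < eps ->
     exists2 g, C0 g /\ D g & Falpha 1 (u - g) (u - g) < eps) /\
  (forall f, C0 f -> forall eps : R, 0 < eps ->
     exists2 g, C0 g /\ D g & forall x, `|f x - g x| < eps).

Definition coresolvent (Gh : R -> (E -> R) -> E -> R) : Prop :=
  forall beta : R, 0 < beta -> forall f, L2 f ->
    D (Gh beta f) /\ forall u, D u -> Falpha beta u (Gh beta f) = inner u f.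

Definition sigma_hat_of (Gh : R -> (E -> R) -> E -> R)
  (sig : R -> {measure set BEE -> \bar R}) : Prop :=
  forall beta : R, 0 < beta -> radonEE (sig beta) /\
    forall u v, C0 u -> C0 v ->
      inner (beta *: Gh beta u) v =
      \int[sig beta]_(p in [set: BEE]) (u p.1 * v p.2).

Definition standing_assumption (J : {measure set BEE -> \bar R}) : Prop :=
  forall f g, C0 f -> D f -> C0 g -> D g ->
    (C0 (f * g) /\ D (f * g)) /\
    J.-integrable (~` diagE : set BEE)
      (fun p : BEE => ((f p.2 - f p.1) * g p.2)%:E).

Definition jump_kill (J : {measure set BEE -> \bar R})
  (K : {measure set BE -> \bar R}) : Prop :=
  radon_offdiag J /\ radonE K /\
  forall u v, C0 u -> D u -> C0 v -> D v ->
    (exists U : set E, exists c : R,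
        open U /\ supp v `<=` U /\ forall x, U x -> u x = c) ->
    F u v = \int[J]_(p in (~` diagE : set BEE)) (2 * (u p.2 - u p.1) * v p.2)
          + \int[K]_(x in [set: BE]) (u x * v x).

Definition exhaustion (J : {measure set BEE -> \bar R})
  (Om : nat -> set E) (vs : nat -> R) : Prop :=
  [/\ (forall l, open (Om l) /\ compact (closure (Om l))),
      (forall l, Om l `<=` Om l.+1) /\ \bigcup_l Om l = setT,
      (forall l, 0 < vs l /\ vs l.+1 <= vs l),
      vs @ \oo --> (0 : R) &
      forall l, let S := [set p : E * E | Om l p.1 /\ Om l p.2 /\
                                          vs l <= rho p.1 p.2] in
        J (closure S `\` interior S) = 0%E].

Definition Lambda (Om : nat -> set E) (vs : nat -> R) (l : nat) : set (E * E) :=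
  [set p | Om l p.1 /\ Om l p.2 /\ rho p.1 p.2 < vs l].

Definition Ec (J : {measure set BEE -> \bar R}) (K : {measure set BE -> \bar R})
  (u v : E -> R) : R :=
  F u v - \int[J]_(p in (~` diagE : set BEE)) (2 * (u p.2 - u p.1) * v p.2)
        - \int[K]_(x in [set: BE]) (u x * v x).

Definition Ehc (sig : R -> {measure set BEE -> \bar R})
  (Om : nat -> set E) (vs : nat -> R) (u v : E -> R) : R :=
  lim ((fun l : nat =>
     lim ((fun beta : R =>
        beta * \int[sig beta]_(p in (Lambda Om vs l : set BEE))
                   ((u p.2 - u p.1) * v p.2)) @ +oo%R)) @ \oo).

Definition Lpair J K sig Om vs (u v f : E -> R) : R :=
  (Ec J K u (v * f) - Ehc sig Om vs u (v * f)) / 2.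

(* signed Radon measure on E, given as mu = mup - mun with mup, mun positive
   Radon measures; mu_c u v (mup, mun) says it is mu^c_<u,v> *)
Definition is_mu_c J K (u v : E -> R)
  (mup mun : {measure set BE -> \bar R}) : Prop :=
  radonE mup /\ radonE mun /\
  forall f, C0 f -> D f ->
    \int[mup]_(x in [set: BE]) f x - \int[mun]_(x in [set: BE]) f x =
    Ec J K u (v * f) + Ec J K v (u * f) - Ec J K (u * v) f.

Definition sint (mup mun : {measure set BE -> \bar R}) (A : set E) (g : E -> R) : R :=
  \int[mup]_(x in (A : set BE)) g x - \int[mun]_(x in (A : set BE)) g x.

End Setting.

Definition setting {R : realType} {E : pmetricType R}
  (m : {measure set borel E -> \bar R}) (D : set (E -> R))
  (F : (E -> R) -> (E -> R) -> R) (Gh : R -> (E -> R) -> E -> R)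
  (J : {measure set borel (E * E)%type -> \bar R})
  (K : {measure set borel E -> \bar R})
  (sig : R -> {measure set borel (E * E)%type -> \bar R})
  (Om : nat -> set E) (vs : nat -> R) : Prop :=
  [/\ locally_compact [set: E] /\ separable_space (E := E),
      radonE m /\ full_support m,
      semi_dirichlet_form m D F /\ regular_form m D F,
      coresolvent m D F Gh /\ sigma_hat_of m Gh sig &
    [/\ standing_assumption D J, jump_kill D F J K & exhaustion J Om vs]].

(* Main.v *)
(* Write s_t for the measure attached to the co-resolvent at t, and x, y for the two
   coordinates. Since E(b, a) = lim_t t ((a, b) - int a(x) b(y) ds_t), every
   identity to be proved becomes a limit of t int H ds_t, where H is a finite sum of
   products a(x) b(y) vanishing on the diagonal.

   The convergence of the forms uses only the completeness of the domain: a family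
   that is bounded in the form norm and tends to 0 in L^2 tends weakly to 0, by
   minimising the norm over convex sets.

   Off the diagonal (t / 2) s_t converges vaguely to the image of J under the
   exchange of coordinates. It does so, by definition of J, on products with disjoint
   supports; these generate an algebra with enough bump functions to approximate
   every continuous function, and then every function whose discontinuities are
   J-negligible. This yields, for a test function phi equal to 1 near supp g and
   G := E - (jump part),
     hat E^c(u, g) = G(g, phi u) - G(u g, phi),
   including the existence of the iterated limit.

   Near the diagonal the kernels H arising in (i) and (iii) are bounded by a small
   multiple of phi(x) phi(y) ((u(y) - u(x))^2 + (v(y) - v(x))^2), whose integrals
   against t s_t stay bounded. Hence H does not see the local part of E, which gives
   (iii), and gives (i) tested against functions of the domain; (i) follows for
   Borel sets because these functions determine signed Radon measures. *)
Require Import Defs.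
From HB Require Import structures.
From mathcomp Require Import all_boot all_order all_algebra.
From mathcomp Require Import all_classical all_reals all_analysis.
From mathcomp Require Import measurable_realfun ring lra.
Import Order.TTheory GRing.Theory Num.Theory.
Import numFieldNormedType.Exports.
Local Open Scope classical_set_scope.
Local Open Scope ring_scope.

(** * Real-valued integrals and their convergence *)

Section IntegralValue.
Context {d : measure_display} {T : measurableType d} {R : realType}.
Variables (mu : {measure set T -> \bar R}) (D : set T).
Hypothesis mD : measurable D.

(** The real-valued integral is a total function, so its value alone says nothing about
    integrability. Carrying both facts lets linear combinations be computed without side
    conditions. *)
Definition has_integral (f : T -> R) (r : R) : Prop :=
  mu.-integrable D (EFin \o f) /\ \int[mu]_(x in D) f x = r.

Lemma has_integral_intro (f : T -> R) :
  mu.-integrable D (EFin \o f) -> has_integral f (\int[mu]_(x in D) f x).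
Proof. by []. Qed.

Lemma has_integral_ext (f g : T -> R) (r : R) :
  {in D, f =1 g} -> has_integral f r -> has_integral g r.
Proof.
move=> fg [fi <-]; split; last by apply: eq_Rintegral => x xD; rewrite fg.
apply: eq_integrable fi => // x xD /=; by rewrite fg.
Qed.

Lemma has_integralD (f g : T -> R) (r s : R) :
  has_integral f r -> has_integral g s ->
  has_integral (fun x => f x + g x) (r + s).
Proof.
move=> [fi <-] [gi <-]; split; last by rewrite RintegralD.
have := integrableD mD fi gi; by apply: eq_integrable => // x _ /=.
Qed.

Lemma has_integralB (f g : T -> R) (r s : R) :
  has_integral f r -> has_integral g s ->
  has_integral (fun x => f x - g x) (r - s).
Proof.
move=> [fi <-] [gi <-]; split; last by rewrite RintegralB.
have := integrableB mD fi gi; by apply: eq_integrable => // x _ /=.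
Qed.

Lemma has_integralZ (k : R) (f : T -> R) (r : R) :
  has_integral f r -> has_integral (fun x => k * f x) (k * r).
Proof.
move=> [fi <-]; split; last by rewrite RintegralZl.
have := integrableZl mD k fi; by apply: eq_integrable => // x _ /=.
Qed.

Lemma integrable_le (f g : T -> R) : measurable_fun D f ->
  (forall x, D x -> `|f x| <= g x) -> mu.-integrable D (EFin \o g) ->
  mu.-integrable D (EFin \o f).
Proof.
move=> mf fg; apply: le_integrable => //; first exact/measurable_EFinP.
by move=> x Dx /=; rewrite lee_fin (le_trans (fg x Dx)) ?ler_norm.
Qed.

Lemma integrable_mul_bounded (f b : T -> R) (M : R) :
  measurable_fun D b -> (forall x, D x -> `|b x| <= M) ->
  mu.-integrable D (EFin \o f) ->
  mu.-integrable D (EFin \o (fun x => f x * b x)).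
Proof.
move=> mb bM fi.
have mf : measurable_fun D f by apply/measurable_EFinP; exact: measurable_int fi.
apply: (@integrable_le _ (fun x => M * `|f x|)).
- exact: measurable_funM.
- by move=> x Dx; rewrite normrM mulrC ler_wpM2r// bM.
- have := integrableZl mD M (integrable_abse fi); exact: eq_integrable.
Qed.

Lemma Rintegral_dominated_cvg (fn : nat -> T -> R) (f g : T -> R) :
  (forall n, measurable_fun D (fn n)) -> measurable_fun D f ->
  mu.-integrable D (EFin \o g) ->
  (forall n x, D x -> `|fn n x| <= g x) ->
  (forall x, D x -> fn n x @[n --> \oo] --> f x) ->
  mu.-integrable D (EFin \o f) /\
  \int[mu]_(x in D) fn n x @[n --> \oo] --> \int[mu]_(x in D) f x.
Proof.
move=> mfn mf gi fng fnf.
have fni n : mu.-integrable D (EFin \o fn n).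
  by apply: integrable_le gi => // x Dx; exact: fng.
have [fi _ h] : [/\ mu.-integrable D (EFin \o f),
   [sequence (\int[mu]_(x in D) `|(fn n x)%:E - (f x)%:E|)%E]_n @ \oo --> 0%E &
   [sequence (\int[mu]_(x in D) (fn n x)%:E)%E]_n @ \oo -->
     (\int[mu]_(x in D) (f x)%:E)%E].
  apply: (@dominated_convergence _ _ _ mu D mD
     (fun n x => (fn n x)%:E) (fun x => (f x)%:E) (fun x => (g x)%:E)) => //.
  - by move=> n; exact/measurable_EFinP.
  - exact/measurable_EFinP.
  - by apply/aeW => x Dx; apply: cvg_EFin; [exact: nearW|exact: fnf].
  - by apply/aeW => x n Dx /=; rewrite lee_fin fng.
split => //.
have := fine_cvg; rewrite /Rintegral => {}H; apply: H.
by rewrite fineK ?integrable_fin_num.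
Qed.

End IntegralValue.

(** * Algebras of functions rich in bumps *)

Section BumpAlgebra.
Context {R : realType} {X : pseudoPMetricType R}.
Implicit Types (A : set (X -> R)) (K O V W : set X) (a f h : X -> R).

(** The value 1 is required around each point of [V]: this makes the plateau open in the covering
    argument, and lets [1 - a] erase the discontinuities of a function. *)
Definition is_bump A O V a : Prop :=
  [/\ A a, (forall x, 0 <= a x <= 1),
      (forall x, V x -> \forall y \near x, a y = 1) &
      (forall x, ~ O x -> a x = 0)].

(** This replaces the hypotheses of a Stone-Weierstrass theorem; no constant other than 0 is
    required. It is applied to [test_fun] on [E] and to [offdiag_algebra] off the diagonal. *)
Definition bump_algebra A W : Prop :=
  [/\ open W, A (fun=> 0) /\ (forall f, A f -> continuous f),
      (forall k f g, A f -> A g -> A (fun x => k * f x + g x)),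
      (forall f g, A f -> A g -> A (fun x => f x * g x)) &
      (forall O x, open O -> O x -> O `<=` W ->
         exists a, is_bump A O [set x] a)].

(** Sets admitting a bump inside [O] are stable under subsets and finite unions. If [K] had no bump,
    the sets [B] such that [K] minus [B] has one would form a proper filter containing [K], and the
    local bump at a cluster point contradicts this. *)
Lemma bump_compact A W K O : bump_algebra A W -> compact K -> open O ->
  K `<=` O -> O `<=` W -> exists a, is_bump A O K a.
Proof.
move=> [oW [A0 Ac] AD AM Aloc] cK oO KO OW.
pose P V := exists a, is_bump A O V a.
have P0 : P set0.
  by exists (fun=> 0); split => // x; rewrite lexx ler01.
have PS V V' : V `<=` V' -> P V' -> P V.
  by move=> VV' [a [? ? aV ?]]; exists a; split => // x /VV' /aV.
have PU V V' : P V -> P V' -> P (V `|` V').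
  move=> [a [Aa a01 aV aO]] [b [Ab b01 bV bO]].
  (* This is [1 - (1 - a) (1 - b)]: it stays in the unit interval and is 1 wherever [a] or [b]
     is. *)
  exists (fun x => (-1) * (a x * b x) + (1 * a x + b x)); split.
  - exact: AD (AM _ _ Aa Ab) (AD _ _ _ Aa Ab).
  - by move=> x; have := a01 x; have := b01 x; nra.
  - move=> x [/aV|/bV]; apply: filterS => y ->; by ring.
  - by move=> x Ox; rewrite aO// bO//; ring.
apply: contrapT => nPK.
pose F : set_system X := [set B | P (K `\` B)].
have FF : ProperFilter F.
  split; first by rewrite /F/= setD0.
  split.
  - by rewrite /F/= setDT.
  - by move=> B C; rewrite /F/= setDIr; exact: PU.
  - by move=> B C BC; apply: PS => x [Kx nC]; split => // /BC.
have FK : F K by rewrite /F/= setDv.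
have [x [Kx clx]] := cK F FF FK.
have [a [Aa a01 ax aO]] := Aloc O x oO (KO x Kx) OW.
have ax1 : nbhs x [set y | \forall z \near y, a z = 1].
  by move: (ax x erefl); rewrite -near_nbhs near_simpl => /nbhs_interior.
have FV : F (~` [set y | \forall z \near y, a z = 1]).
  by exists a; split => // y [_ /contrapT].
by have [y []] := clx _ _ FV ax1.
Qed.

(** Greedy approximation from below. Take a bump that is 1 where the remainder is at least two
    thirds of its bound and 0 where it is at most one third; adding one third of the bound times
    this bump shrinks the bound by the factor 2/3. *)
Lemma bump_approx A W K h (M : R) : bump_algebra A W -> compact K -> K `<=` W ->
  continuous h -> 0 < M -> (forall x, 0 <= h x <= M) ->
  (forall x, ~ K x -> h x = 0) ->
  forall n, exists f, [/\ A f, (forall x, 0 <= h x - f x <= (2 / 3) ^+ n * M) &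
                        (forall x, ~ K x -> f x = 0)].
Proof.
move=> HA cK KW ch M0 hM hK; have [oW [A0 Ac] AD AM Aloc] := HA.
elim=> [|n [f [Af fM fK]]].
  by exists (fun=> 0); split => // x; rewrite subr0 expr0 mul1r.
set Mn := (2 / 3) ^+ n * M in fM.
have Mn0 : 0 < Mn by rewrite mulr_gt0// exprn_gt0.
have MnS : (2 / 3) ^+ n.+1 * M = 2 / 3 * Mn by rewrite exprS -mulrA.
clearbody Mn.
pose g x := h x - f x.
have cg : continuous g.
  by move=> x; apply: cvgB; [exact: ch|exact: Ac].
have op : open ([set x | Mn / 3 < g x] `&` W).
  by apply: openI => //; move/continuousP : cg => /(_ _ (@open_gt R (Mn / 3))).
have cp : compact (K `&` [set x | Mn * (2 / 3) <= g x]).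
  apply: compact_closedI => //.
  by move/continuous_closedP : cg => /(_ _ (@closed_ge R (Mn * (2 / 3)))).
(* The remainder vanishes off [K], so a bump living where it exceeds [Mn / 3] vanishes there too. *)
have [|a [Aa a01 aK aO]] := bump_compact _ _ _ _ HA cp op _ (@subIsetr _ _ _).
  move=> x [Kx /= gx]; split; last exact: KW.
  by rewrite /=; apply: lt_le_trans gx; move: Mn0; lra.
exists (fun x => (Mn / 3) * a x + f x); split.
- exact: AD.
- move=> x; rewrite MnS.
  have [gx|gx] := leP (Mn * (2 / 3)) (g x).
    have [Kx|nKx] := pselect (K x).
      have -> : a x = 1 by exact: nbhs_singleton (aK x (conj Kx gx)).
      by move: (fM x) gx Mn0 => /andP[]; rewrite /g; lra.
    by move: gx; rewrite /g hK// fK//; move: Mn0; lra.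
  have [gx'|gx'] := ltP (Mn / 3) (g x).
    by have := a01 x; have := fM x; move: gx gx' Mn0; rewrite /g; nra.
  rewrite aO; last by move=> [/=]; rewrite ltNge gx'.
  by have := fM x; move: gx gx' Mn0; rewrite /g; lra.
- move=> x nKx; rewrite fK// aO ?mulr0 ?addr0//.
  by move=> [/= + _]; rewrite /g hK// fK// subrr; move: Mn0; lra.
Qed.

(** These bumps converge pointwise to the indicator of [K] under a common majorant from the algebra,
    which is the input of dominated convergence. *)
Lemma bump_sequence A W K : hausdorff_space X -> bump_algebra A W ->
  compact K -> K `<=` W ->
  exists (a0 : X -> R) (an : nat -> X -> R),
    [/\ is_bump A W K a0, (forall n, is_bump A W K (an n)),
        (forall n x, an n x <= a0 x) &
        (forall x, ~ K x -> \forall n \near \oo, an n x = 0)].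
Proof.
move=> hX HA cK KW; have [oW [A0 Ac] AD AM Aloc] := HA.
pose O n := (\bigcup_(z in K) (ball z n.+1%:R^-1)°) `&` W.
have oO n : open (O n) by apply: openI => //; apply: bigcup_open => z _; exact: open_interior.
have KO n : K `<=` O n.
  move=> x Kx; split; last exact: KW.
  by exists x => //; apply: nbhsx_ballx; rewrite invr_gt0.
have [b bP] := choice (fun n => bump_compact _ _ _ _ HA cK (oO n) (KO n) (@subIsetr _ _ _)).
have b0W : is_bump A W K (b 0%N).
  have [? ? ? bO] := bP 0%N; split => // x nW; apply: bO => -[]//.
(* The factor [b 0] provides the common majorant. *)
exists (b 0%N), (fun n x => b 0%N x * b n x); split => //.
- move=> n; have [Ab b01 bK bO] := b0W; have [Ac' c01 cK' cO] := bP n; split.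
  + exact: AM.
  + by move=> x; have := b01 x; have := c01 x; nra.
  + move=> x Kx; near=> y; rewrite (near (bK x Kx) y)// (near (cK' x Kx) y)// mulr1//.
  + by move=> x nW; rewrite bO// mul0r.
- move=> n x; have [_ b01 _ _] := bP 0%N; have [_ c01 _ _] := bP n.
  by have := b01 x; have := c01 x; nra.
- move=> x nKx.
  have /nbhs_ballP[e e0 be] : nbhs x (~` K).
    by apply: open_nbhs_nbhs; split => //; apply: closed_openC; exact: compact_closed.
  near=> n; have [_ _ _ ->] := bP n; first by rewrite mulr0.
  move=> [[z Kz /interior_subset zx] _].
  apply: (be z) => //=; apply: ball_sym; apply: le_ball zx.
  apply: ltW; near: n; exact: near_infty_natSinv_lt (PosNum e0).
Unshelve. all: by end_near.
Qed.

End BumpAlgebra.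

(** * Borel measurability and integrability over compact sets *)

Section BorelMeasurability.
Context {R : realType} {X : pseudoPMetricType R}.

Lemma borel_open (O : set X) : open O -> measurable (O : set (borel X)).
Proof. by move=> oO; apply: sub_sigma_algebra. Qed.

Lemma borel_closed (C : set X) : closed C -> measurable (C : set (borel X)).
Proof.
by move=> /closed_openC/borel_open/measurableC; rewrite setCK.
Qed.

Lemma borel_continuous (f : X -> R) :
  continuous f -> measurable_fun [set: borel X] (f : borel X -> R).
Proof.
move=> /continuousP cf; apply: (measurability _ (RGenOpens.measurableE R)).
move=> _ [_ [a [b ->] <-]]; rewrite setTI; apply: borel_open; apply: cf.
exact: interval_open.
Qed.

Lemma integrable_compact_support (mu : {measure set borel X -> \bar R})
    (f : X -> R) (K : set X) (M : R) :
  measurable (K : set (borel X)) -> (mu K < +oo)%E ->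
  measurable_fun [set: borel X] (f : borel X -> R) ->
  (forall x, `|f x| <= M) -> (forall x, ~ K x -> f x = 0) ->
  mu.-integrable [set: borel X] (EFin \o f).
Proof.
move=> mK muK mf fM fK.
have fi : mu.-integrable K (EFin \o (f : borel X -> R)).
  apply: measurable_bounded_integrable => //.
  - exact: measurable_funS mf.
  - exists M; split; first exact: num_real.
    by move=> y My x _ /=; apply: le_trans (fM x) (ltW My).
have -> : (EFin \o f : borel X -> \bar R) = (EFin \o f) \_ K.
  apply/funext => x; rewrite /patch; case: ifPn => //.
  by rewrite notin_setE => /fK /= ->.
exact/(integrable_mkcond _ mK).1.
Qed.

End BorelMeasurability.

(** * Vague convergence of weighted measures *)

Section VagueConvergence.
Context {R : realType} {X : pseudoPMetricType R}.
Variables (c : R -> R) (mu : R -> {measure set borel X -> \bar R}).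
Variable nu : {measure set borel X -> \bar R}.
Hypothesis c_ge0 : forall b : R, 0 < b -> 0 <= c b.

Definition vague_cvg (q : X -> R) : Prop :=
  [/\ measurable_fun [set: borel X] (q : borel X -> R),
      (forall b : R, 0 < b -> (mu b).-integrable [set: borel X] (EFin \o q)),
      nu.-integrable [set: borel X] (EFin \o q) &
      (fun b => c b * \int[mu b]_(x in [set: borel X]) q x) @ +oo -->
        \int[nu]_(x in [set: borel X]) q x].

Let near_pos : \forall b \near (+oo : set_system R), 0 < b.
Proof. exact: nbhs_pinfty_gt. Qed.

Lemma vague_cvg_lin (k : R) (f g : X -> R) : vague_cvg f -> vague_cvg g ->
  vague_cvg (fun x => k * f x + g x).
Proof.
move=> [mf fi fn fc] [mg gi gn gc].
have I (m : {measure set borel X -> \bar R}) :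
    m.-integrable [set: borel X] (EFin \o f) ->
    m.-integrable [set: borel X] (EFin \o g) ->
    has_integral m [set: borel X] (fun x => k * f x + g x)
      (k * (\int[m]_(x in [set: borel X]) f x) + \int[m]_(x in [set: borel X]) g x).
  by move=> fI gI; apply: has_integralD => //; apply: has_integralZ.
split.
- by apply: measurable_funD => //; apply: measurable_funM.
- by move=> b b0; have [] := I (mu b) (fi b b0) (gi b b0).
- by have [] := I nu fn gn.
- have [_ ->] := I nu fn gn.
  apply: cvg_trans (cvgD (cvgMl_tmp (a := k) fc) gc).
  apply: near_eq_cvg; near=> b.
  have b0 : 0 < b by near: b.
  have [_ ->] := I (mu b) (fi b b0) (gi b b0).
  by rewrite mulrDr (mulrCA (c b)).
Unshelve. all: by end_near.
Qed.

(** Total masses may be infinite, so the error is controlled by a function [s] with small integrals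
    instead of a uniform bound; the conclusion is then a three-term estimate. *)
Lemma vague_cvg_squeeze (q : X -> R) :
  measurable_fun [set: borel X] (q : borel X -> R) ->
  (forall e : R, 0 < e -> exists h s : X -> R,
    [/\ vague_cvg h, (forall x, `|q x - h x| <= s x),
        (forall b : R, 0 < b -> (mu b).-integrable [set: borel X] (EFin \o s)) /\
        nu.-integrable [set: borel X] (EFin \o s),
        (\forall b \near (+oo : set_system R),
          c b * \int[mu b]_(x in [set: borel X]) s x <= e) &
        \int[nu]_(x in [set: borel X]) s x <= e]) ->
  vague_cvg q.
Proof.
move=> mq Hq.
have I (m : {measure set borel X -> \bar R}) (h s : X -> R) :
    m.-integrable [set: borel X] (EFin \o h) ->
    m.-integrable [set: borel X] (EFin \o s) ->
    (forall x, `|q x - h x| <= s x) ->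
    m.-integrable [set: borel X] (EFin \o q).
  move=> hi si qhs.
  have hI := has_integralD m _ measurableT _ _ _ _
    (has_integral_intro _ _ _ (integrable_abse hi)) (has_integral_intro _ _ _ si).
  apply: (@integrable_le _ _ _ m _ measurableT q (fun x => `|h x| + s x) mq) => //.
  - move=> x _; rewrite -[q x](subrK (h x)) (le_trans (ler_normD _ _))// addrC.
    by rewrite lerD2l.
  - by case: hI.
have D (m : {measure set borel X -> \bar R}) (h s : X -> R) :
    m.-integrable [set: borel X] (EFin \o h) ->
    m.-integrable [set: borel X] (EFin \o s) ->
    (forall x, `|q x - h x| <= s x) ->
    `|\int[m]_(x in [set: borel X]) q x - \int[m]_(x in [set: borel X]) h x|
    <= \int[m]_(x in [set: borel X]) s x.
  move=> hi si qhs; have qi := I _ _ _ hi si qhs.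
  have [qhi <-] := has_integralB m _ measurableT _ _ _ _
    (has_integral_intro _ _ _ qi) (has_integral_intro _ _ _ hi).
  rewrite (le_trans (le_normr_Rintegral _ qhi))//.
  apply: le_Rintegral => //; exact: integrable_abse qhi.
have [h1 [s1 [[_ h1i h1n _] qs1 [s1i s1n] _ _]]] := Hq 1 ltr01.
split => //.
- by move=> b b0; apply: I (h1i b b0) (s1i b b0) qs1.
- exact: I h1n s1n qs1.
apply/cvgrPdist_le => e e0.
have e30 : 0 < e / 3 by rewrite divr_gt0.
have [h [s [[_ hi hn hc] qs [si sn] sb sl]]] := Hq _ e30.
move/cvgrPdist_le : hc => /(_ _ e30) hc.
near=> b.
have b0 : 0 < b by near: b.
have A1 := D _ _ _ hn sn qs.
have A2 := D _ _ _ (hi b b0) (si b b0) qs.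
have A3 : c b * \int[mu b]_(x in [set: borel X]) s x <= e / 3 by near: b.
have A4 : `|\int[nu]_(x in [set: borel X]) h x -
            c b * \int[mu b]_(x in [set: borel X]) h x| <= e / 3 by near: b.
have A5 := c_ge0 b b0.
have arith (qn qb hn' hb sn' sb' cb : R) : 0 <= cb -> `|qn - hn'| <= sn' ->
    `|qb - hb| <= sb' -> cb * sb' <= e / 3 -> `|hn' - cb * hb| <= e / 3 ->
    sn' <= e / 3 -> `|qn - cb * qb| <= e.
  move=> cb0 B1 B2 B3 B4 B5.
  have B6 : `|cb * qb - cb * hb| <= cb * sb'.
    by rewrite -mulrBr normrM (ger0_norm cb0) ler_wpM2l.
  move: B1 B4 B6; rewrite !ler_norml; lra.
exact: arith A5 A1 A2 A3 A4 sl.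
Unshelve. all: by end_near.
Qed.

Hypothesis hX : hausdorff_space X.
Variables (A : set (X -> R)) (W : set X).
Hypothesis bA : bump_algebra A W.
Hypothesis vA : forall f, A f -> vague_cvg f.

Let vague_cvg_small (f : X -> R) (M e : R) :
  vague_cvg f -> 0 <= M -> 0 < e ->
  M * \int[nu]_(x in [set: borel X]) f x < e ->
  [/\ (forall b : R, 0 < b -> (mu b).-integrable [set: borel X] (EFin \o (fun x => M * f x))),
      nu.-integrable [set: borel X] (EFin \o (fun x => M * f x)),
      (\forall b \near (+oo : set_system R),
          c b * \int[mu b]_(x in [set: borel X]) (M * f x) <= e) &
      \int[nu]_(x in [set: borel X]) (M * f x) <= e].
Proof.
move=> [mf fi fn fc] M0 e0 fe.
have I (m : {measure set borel X -> \bar R})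
    (i : m.-integrable [set: borel X] (EFin \o f)) :=
  has_integralZ m _ measurableT M _ _ (has_integral_intro _ _ _ i).
split.
- by move=> b b0; case: (I _ (fi b b0)).
- by case: (I _ fn).
- have : \forall b \near (+oo : set_system R),
     M * (c b * \int[mu b]_(x in [set: borel X]) f x) < e.
    by apply: (cvgr_lt _ (cvgMl_tmp (a := M) fc)).
  apply: filterS2 near_pos => b b0 H; have [_ ->] := I _ (fi b b0).
  by rewrite mulrCA ltW.
- by have [_ ->] := I _ fn; rewrite ltW.
Qed.

(** The uniform error of [bump_approx] lives on [K], so it is at most a small multiple of one fixed
    bump [a], whose weighted integrals converge and hence stay bounded. *)
Lemma vague_cvg_continuous_ge0 (h : X -> R) (K : set X) (M : R) :
  compact K -> K `<=` W -> continuous h -> (forall x, 0 <= h x <= M) ->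
  (forall x, ~ K x -> h x = 0) -> vague_cvg h.
Proof.
move=> cK KW ch hM hK; have [oW _ _ _ _] := bA.
have [M0|M0] := leP M 0.
  have -> : h = fun=> 0 by apply/funext => x; have := hM x; move: M0; lra.
  by apply: vA; case: bA => _ [].
have [a [Aa a01 aK aW]] := bump_compact _ _ _ _ bA cK oW KW (@subset_refl _ _).
set I := \int[nu]_(x in [set: borel X]) a x.
have I0 : 0 <= I by apply: Rintegral_ge0 => x _; case/andP: (a01 x).
apply: vague_cvg_squeeze; first exact: borel_continuous.
move=> e e0.
have [n nlt] : exists n, (2 / 3) ^+ n * M * I < e.
  have : (2 / 3) ^+ n * (M * I) @[n --> \oo] --> (0 * (M * I) : R).
    by apply: cvgMr_tmp; apply: cvg_expr; rewrite ger0_norm; lra.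
  rewrite mul0r => /(cvgr_lt (0:R)) /(_ _ e0) [n _ /(_ n (leqnn n)) H].
  by exists n; rewrite -mulrA.
have [f [Af fM fK]] := bump_approx _ _ _ _ _ bA cK KW ch M0 hM hK n.
exists f, (fun x => (2 / 3) ^+ n * M * a x).
have Mn0 : 0 <= (2 / 3) ^+ n * M by rewrite mulr_ge0 ?exprn_ge0 ?(ltW M0)//; lra.
have [? ? ? ?] := vague_cvg_small a _ e (vA _ Aa) Mn0 e0 nlt.
split => //; first exact: vA.
move=> x; have [Kx|nKx] := pselect (K x).
  rewrite (nbhs_singleton (aK x Kx)) mulr1 ger0_norm; by have /andP[] := fM x.
rewrite hK// fK// subrr normr0 mulr_ge0//; by case/andP: (a01 x).
Qed.

Lemma vague_cvg_continuous (h : X -> R) (K : set X) (M : R) :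
  compact K -> K `<=` W -> continuous h -> (forall x, `|h x| <= M) ->
  (forall x, ~ K x -> h x = 0) -> vague_cvg h.
Proof.
move=> cK KW ch hM hK.
have cmax (g : X -> R) : continuous g -> continuous (fun x => Num.max (g x) 0).
  by move=> cg x; exact: (@continuous_max R X g (fun=> 0) x (cg x) (cvg_cst _)).
have -> : h = fun x => (-1) * Num.max (- h x) 0 + Num.max (h x) 0.
  by apply/funext => x; rewrite !maxEle; case: ifP; case: ifP; lra.
apply: vague_cvg_lin; apply: (vague_cvg_continuous_ge0 _ K M) => //.
- by apply: cmax => x; apply: cvgN; exact: ch.
- move=> x; have := hM x; rewrite ler_norml maxEle; case: ifP; lra.
- by move=> x /hK ->; rewrite oppr0 maxxx.
- exact: cmax.
- move=> x; have := hM x; rewrite ler_norml maxEle; case: ifP; lra.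
- by move=> x /hK ->; rewrite maxxx.
Qed.

(* Multiplying by 1 - a, with a bump a equal to 1 around the discontinuities and
   of small integral, turns q into a continuous function. *)
Lemma vague_cvg_ae_continuous (q : X -> R) (K Z : set X) (M : R) :
  measurable_fun [set: borel X] (q : borel X -> R) ->
  compact K -> K `<=` W -> (forall x, `|q x| <= M) ->
  (forall x, ~ K x -> q x = 0) -> compact Z -> Z `<=` W -> nu Z = 0%E ->
  (forall x, ~ Z x -> {for x, continuous q}) -> vague_cvg q.
Proof.
move=> mq cK KW qM qK cZ ZW nuZ qc; have [oW [_ Ac] _ _ _] := bA.
have M0 : 0 <= M by apply: le_trans (qM point); exact: normr_ge0.
have mZ : measurable (Z : set (borel X)).
  by apply: borel_closed; exact: compact_closed.
(* The bumps shrink to [Z], so their integrals under [nu] tend to [nu Z], that is to 0. *)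
have [a0 [an [[Aa0 a001 _ _] anP ana0 anZ]]] := bump_sequence _ _ _ hX bA cZ ZW.
have [_ lim0] : nu.-integrable [set: borel X] (EFin \o (\1_Z : borel X -> R)) /\
    \int[nu]_(x in [set: borel X]) an n x @[n --> \oo] -->
    \int[nu]_(x in [set: borel X]) (\1_Z x : R).
  apply: (@Rintegral_dominated_cvg _ _ _ nu _ measurableT an (\1_Z) a0).
  - by move=> n; apply: borel_continuous; have [Aan _ _ _] := anP n; exact: Ac.
  - exact: measurable_indic.
  - by have [] := vA _ Aa0.
  - move=> n x _; have [_ a01 _ _] := anP n; have /andP[? ?] := a01 x.
    by rewrite ger0_norm.
  - move=> x _; rewrite indicE; have [Zx|nZx] := pselect (Z x).
      rewrite mem_set//; apply: cvg_near_cst; apply: nearW => n.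
      by have [_ _ aZ _] := anP n; rewrite (nbhs_singleton (aZ x Zx)).
    by rewrite memNset//; apply: cvg_near_cst; exact: anZ.
have I0 : \int[nu]_(x in [set: borel X]) (\1_Z x : R) = 0.
  by rewrite /Rintegral integral_indic// setIT nuZ.
rewrite I0 in lim0.
apply: vague_cvg_squeeze => // e e0.
have [n nlt] : exists n, M * \int[nu]_(x in [set: borel X]) an n x < e.
  have : M * \int[nu]_(x in [set: borel X]) an n x @[n --> \oo] --> (M * 0 : R).
    exact: cvgMl_tmp.
  rewrite mulr0 => /(cvgr_lt (0:R)) /(_ _ e0) [n _ /(_ n (leqnn n)) H].
  by exists n.
have [Aan a01 aZ aW] := anP n.
exists (fun x => q x * (1 - an n x)), (fun x => M * an n x).
have [? ? ? ?] := vague_cvg_small _ _ e (vA _ Aan) M0 e0 nlt.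
split => //; last first.
  move=> x; rewrite mulrBr mulr1 opprB addrC subrK normrM.
  by have /andP[? ?] := a01 x; rewrite (ger0_norm (x := an n x))// ler_wpM2r.
apply: (vague_cvg_continuous _ K M) => //.
- move=> x; have [Zx|nZx] := pselect (Z x); last first.
    apply: cvgM; first exact: qc.
    by apply: cvgB; [exact: cvg_cst|exact: Ac].
  (* Around a point of [Z] the second factor vanishes identically, so the product is continuous
     there whatever [q] does. *)
  have E : \forall y \near x, q y * (1 - an n y) = 0.
    by apply: filterS (aZ x Zx) => y ->; rewrite subrr mulr0.
  rewrite /continuous_at (nbhs_singleton E); exact: cvg_near_cst.
- move=> x; rewrite normrM -[leRHS]mulr1 ler_pM//.
  by have := a01 x; rewrite ler_norml; lra.
- by move=> x /qK ->; rewrite mul0r.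
Qed.

End VagueConvergence.

(** * Convergence of the approximating forms of the co-resolvent *)

Section FormConvergence.
Context {R : realType} {E : pmetricType R}.
Variables (m : {measure set borel E -> \bar R}) (D : set (E -> R)).
Variable F : (E -> R) -> (E -> R) -> R.
Hypothesis HF : semi_dirichlet_form m D F.

Lemma form_L2 u : D u -> L2 m u.
Proof. by have [[DL _] _ _ _ _] := HF; exact: DL. Qed.

Lemma form_dom0 : D 0.
Proof. by have [_ [? _] _ _ _] := HF. Qed.

Lemma form_domlin (a : R) u v : D u -> D v -> D (a *: u + v).
Proof. by have [_ [_ h] _ _ _] := HF; exact: h. Qed.

Lemma form_domZ (a : R) u : D u -> D (a *: u).
Proof. by move=> Du; have := form_domlin a _ _ Du form_dom0; rewrite addr0. Qed.

Lemma form_domB u v : D u -> D v -> D (u - v).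
Proof. by move=> Du Dv; rewrite addrC -scaleN1r; exact: form_domlin. Qed.

Lemma L2_mul_integrable u v : L2 m u -> L2 m v ->
  m.-integrable [set: borel E] (EFin \o (fun x => u x * v x)).
Proof.
move=> [mu ui] [mv vi].
apply: (@integrable_le _ _ _ m _ measurableT _ (fun x => u x ^+ 2 + v x ^+ 2)).
- exact: measurable_funM.
- move=> x _; rewrite ler_norml; apply/andP; split; nra.
- have [//] := has_integralD m _ measurableT _ _ _ _
    (has_integral_intro m _ (fun x => u x ^+ 2) ui)
    (has_integral_intro m _ (fun x => v x ^+ 2) vi).
Qed.

Lemma innerC u v : inner m u v = inner m v u.
Proof. by apply: eq_Rintegral => x _; rewrite mulrC. Qed.

Lemma inner_linl (a : R) u v w : D u -> D v -> D w ->
  inner m (a *: u + v) w = a * inner m u w + inner m v w.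
Proof.
move=> /form_L2 Lu /form_L2 Lv /form_L2 Lw.
have [_ <-] := has_integralD m _ measurableT _ _ _ _
    (has_integralZ m _ measurableT a _ _
       (has_integral_intro m _ _ (L2_mul_integrable _ _ Lu Lw)))
    (has_integral_intro m _ _ (L2_mul_integrable _ _ Lv Lw)).
by apply: eq_Rintegral => x _; rewrite mulrA -mulrDl.
Qed.

Lemma inner_ge0 u : 0 <= inner m u u.
Proof. by apply: Rintegral_ge0 => x _; rewrite -expr2 sqr_ge0. Qed.

Local Notation B := (Falpha m F 1).
Local Notation N u := (Falpha m F 1 u u).

Lemma form_linl (a : R) u v w : D u -> D v -> D w ->
  F (a *: u + v) w = a * F u w + F v w.
Proof. by have [_ _ h _ _] := HF => Du Dv Dw; have [] := h a u v w Du Dv Dw. Qed.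

Lemma form_linr (a : R) u v w : D u -> D v -> D w ->
  F w (a *: u + v) = a * F w u + F w v.
Proof. by have [_ _ h _ _] := HF => Du Dv Dw; have [] := h a u v w Du Dv Dw. Qed.

Lemma inner_linr (a : R) u v w : D u -> D v -> D w ->
  inner m w (a *: u + v) = a * inner m w u + inner m w v.
Proof. by move=> Du Dv Dw; rewrite innerC inner_linl// innerC (innerC w v). Qed.

Lemma form1_linr (a : R) u v w : D u -> D v -> D w ->
  B w (a *: u + v) = a * B w u + B w v.
Proof. by move=> *; rewrite /Falpha form_linr// inner_linr//; ring. Qed.

Lemma form1_linl (a : R) u v w : D u -> D v -> D w ->
  B (a *: u + v) w = a * B u w + B v w.
Proof. by move=> *; rewrite /Falpha form_linl// inner_linl//; ring. Qed.

Lemma form_ge0 u : D u -> 0 <= F u u.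
Proof. by have [_ _ _ _ [h _ _ _]] := HF; exact: h. Qed.

Lemma inner_le_form1 u : D u -> inner m u u <= N u.
Proof. by move=> Du; rewrite /Falpha mul1r lerDr form_ge0. Qed.

Lemma form1_ge0 u : D u -> 0 <= N u.
Proof. by move=> Du; apply: le_trans (inner_le_form1 u Du); exact: inner_ge0. Qed.

Lemma form_0r v : D v -> F v 0 = 0.
Proof.
move=> Dv; have := form_linr (-1) 0 0 v form_dom0 form_dom0 Dv.
by rewrite scaler0 addr0; lra.
Qed.

Lemma inner_Zl (a : R) u v : D u -> D v -> inner m (a *: u) v = a * inner m u v.
Proof.
move=> Du Dv; have -> : a *: u = (a - 1) *: u + u.
  by rewrite -[X in _ = _ + X]scale1r -scalerDl subrK.
by rewrite inner_linl//; ring.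
Qed.

Lemma form1_Zl (a : R) u v : D u -> D v -> B (a *: u) v = a * B u v.
Proof.
move=> Du Dv; have -> : a *: u = (a - 1) *: u + u.
  by rewrite -[X in _ = _ + X]scale1r -scalerDl subrK.
by rewrite form1_linl//; ring.
Qed.

Lemma form1_Zr (a : R) u v : D u -> D v -> B v (a *: u) = a * B v u.
Proof.
move=> Du Dv; have -> : a *: u = (a - 1) *: u + u.
  by rewrite -[X in _ = _ + X]scale1r -scalerDl subrK.
by rewrite form1_linr//; ring.
Qed.

Lemma inner_sqr (s : R) u v : D u -> D v ->
  inner m (s *: u + v) (s *: u + v) =
  s ^+ 2 * inner m u u + 2 * s * inner m u v + inner m v v.
Proof.
move=> Du Dv; rewrite inner_linr//; last exact: form_domlin.
by rewrite !inner_linl// (innerC v u); ring.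
Qed.

Lemma inner_amgm (t : R) u v : 0 < t -> D u -> D v ->
  `|inner m u v| <= t * inner m u u + t^-1 * inner m v v.
Proof.
move=> t0 Du Dv.
have P s : 0 <= s ^+ 2 * inner m u u + 2 * s * inner m u v + inner m v v.
  by rewrite -inner_sqr// inner_ge0.
have U0 := inner_ge0 u; have V0 := inner_ge0 v.
rewrite ler_norml; apply/andP; split.
- have : 0 <= t^-1 * (t ^+ 2 * inner m u u + 2 * t * inner m u v + inner m v v).
    by rewrite mulr_ge0// invr_ge0 ltW.
  have -> : t^-1 * (t ^+ 2 * inner m u u + 2 * t * inner m u v + inner m v v) =
     t * inner m u u + 2 * inner m u v + t^-1 * inner m v v.
    by field; rewrite gt_eqF.
  have : 0 <= t * inner m u u + t^-1 * inner m v v.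
    by rewrite addr_ge0// mulr_ge0// ?invr_ge0 ltW.
  lra.
- have : 0 <= t^-1 * ((- t) ^+ 2 * inner m u u + 2 * (- t) * inner m u v + inner m v v).
    by rewrite mulr_ge0// invr_ge0 ltW.
  have -> : t^-1 * ((- t) ^+ 2 * inner m u u + 2 * (- t) * inner m u v + inner m v v) =
     t * inner m u u - 2 * inner m u v + t^-1 * inner m v v.
    by field; rewrite gt_eqF.
  have : 0 <= t * inner m u u + t^-1 * inner m v v.
    by rewrite addr_ge0// mulr_ge0// ?invr_ge0 ltW.
  lra.
Qed.

Lemma inner_small u (e : R) : D u -> 0 < e -> exists2 delta, 0 < delta &
  forall d, D d -> inner m d d <= delta -> `|inner m u d| <= e.
Proof.
move=> Du e0; have U0 := inner_ge0 u.
(* This weight makes the first term of [inner_amgm] at most [e / 2]; the choice of [delta] below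
   does the same for the second. *)
pose t := e / (2 * (inner m u u + 1)).
have t0 : 0 < t by rewrite divr_gt0// mulr_gt0//; lra.
have tU : t * inner m u u <= e / 2.
  have -> : t * inner m u u = e / 2 * (inner m u u / (inner m u u + 1)).
    by rewrite /t; field; rewrite gt_eqF//; lra.
  rewrite ler_piMr//; first lra.
  by rewrite ler_pdivrMr; lra.
exists (t * (e / 2)); first by rewrite mulr_gt0//; lra.
move=> d Dd dd; apply: le_trans (inner_amgm t _ _ t0 Du Dd) _.
have : t^-1 * inner m d d <= e / 2 by rewrite ler_pdivrMl.
lra.
Qed.

(** Elements of L2 are functions here, so a zero norm only gives equality with 0 almost everywhere;
    the form does not distinguish representatives. *)
Lemma inner0_form0 u c : D u -> D c -> inner m c c = 0 -> F u c = 0.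
Proof.
move=> Du Dc cc0; have [[_ rep] _ _ _ _] := HF.
rewrite -(form_0r u Du).
have ae0 : aeeq m c 0.
  have ci := L2_mul_integrable _ _ (form_L2 _ Dc) (form_L2 _ Dc).
  have I0 : (\int[m]_(x in [set: borel E]) `|(c x * c x)%:E| = 0)%E.
    have -> : (\int[m]_(x in [set: borel E]) `|(c x * c x)%:E| =
               \int[m]_(x in [set: borel E]) (c x * c x)%:E)%E.
      by apply: eq_integral => x _; rewrite gee0_abs// lee_fin -expr2 sqr_ge0.
    by rewrite -[LHS]fineK ?integrable_fin_num//; congr EFin; exact: cc0.
  have [mc _] := form_L2 _ Dc.
  have mcc : measurable_fun [set: borel E] (fun x : borel E => (c x * c x)%:E).
    by apply/measurable_EFinP; exact: measurable_funM.
  have := (ae_eq_integral_abs m measurableT mcc).1 I0.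
  apply: filterS => x /(_ I) /= [].
  by move/eqP; rewrite mulf_eq0 orbb => /eqP.
by have [_ /(_ _ Du) []] := rep c 0 Dc (form_L2 _ form_dom0) ae0.
Qed.

(* Otherwise the sets S n below are nonempty, convex, decreasing and of bounded
   minimal norm; by the parallelogram law almost-minimal elements form a Cauchy
   sequence, whose limit is 0 in L2 but on which B u is at least e. *)
Lemma form1_small u (M e : R) : D u -> 0 < e -> exists2 delta, 0 < delta &
  forall d, D d -> N d <= M -> inner m d d <= delta -> `|B u d| <= e.
Proof.
move=> Du e0; have [_ _ _ _ [_ [Ks Ks0 sector] complete _]] := HF.
apply: contrapT => nex.
have [r [iS0 rdec rlt]] : exists r : nat -> R, [/\ (forall n, 0 < r n),
    (forall n k, (n <= k)%N -> r k <= r n) &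
    (forall eps, 0 < eps -> \forall n \near \oo, r n < eps)].
  exists (fun n => n.+1%:R^-1); split.
  - by move=> n; rewrite invr_gt0.
  - by move=> n k nk; rewrite lef_pV2 ?posrE// ler_nat.
  - by move=> eps eps0; exact: near_infty_natSinv_lt (PosNum eps0).
have ex n : exists d, [/\ D d, N d <= M, inner m d d <= r n & e <= B u d].
  apply: contrapT => nd; apply: nex; exists (r n) => // d Dd dM dn.
  have Bu a : D a -> N a <= M -> inner m a a <= r n -> B u a <= e.
    move=> Da Na aa; rewrite leNgt; apply/negP => ea; apply: nd.
    by exists a; split => //; exact: ltW.
  rewrite ler_norml Bu// andbT.
  (* The constraints are even in [d], so testing with [-d] yields the lower bound. *)
  have Dd' : D (-1 *: d) by exact: form_domZ.
  have E1 : B u (-1 *: d) = - B u d by rewrite form1_Zr// mulN1r.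
  have E2 : N (-1 *: d) = N d by rewrite form1_Zr ?form1_Zl//; ring.
  have E3 : inner m (-1 *: d) (-1 *: d) = inner m d d.
    by apply: eq_Rintegral => x _; rewrite scaleN1r mulrNN.
  by have := Bu (-1 *: d); rewrite E1 E2 E3 => /(_ Dd' dM dn); lra.
pose S n := [set c | [/\ D c, inner m c c <= r n & e <= B u c]].
pose I n := inf [set N c | c in S n].
have Slb n : has_lbound [set N c | c in S n].
  by exists 0 => _ [c [Dc _ _] <-]; exact: form1_ge0.
have Sinf n : has_inf [set N c | c in S n].
  by split => //; have [d [Dd _ dn ed]] := ex n; exists (N d), d.
have IleN n c : S n c -> I n <= N c by move=> Sc; apply: ge_inf => //; exists c.
have Sdec n k : (n <= k)%N -> S k `<=` S n.
  move=> nk c [Dc cn ec]; split => //; apply: le_trans cn _.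
  exact: rdec.
have Iinc : {homo I : n k / (n <= k)%N >-> n <= k}.
  move=> n k nk; apply: lb_le_inf; first by case: (Sinf k).
  by move=> _ [c Sc <-]; apply: IleN; exact: Sdec Sc.
have IM n : I n <= M.
  by have [d [Dd dM dn ed]] := ex n; apply: le_trans dM; exact: IleN.
have exc n : exists c, S n c /\ N c < I n + r n.
  by have [_ [c Sc <-] cI] := inf_adherent (iS0 n) (Sinf n); exists c.
have [c cP] := choice exc.
have Dc n : D (c n) by have [[]] := cP n.
have Icvg : cvgn I.
  by apply: nondecreasing_is_cvgn => //; exists M => _ [n _ <-].
(* The cross terms enter symmetrically, so the parallelogram law holds for [N] although [B] need not
   be symmetric. *)
have para a b : D a -> D b ->
    N (a - b) = 2 * N a + 2 * N b - 4 * N (2^-1 *: a + 2^-1 *: b).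
  move=> Da Db; have Db' := form_domZ 2^-1 _ Db.
  have -> : N (a - b) = N a + N b - B a b - B b a.
    have -> : a - b = -1 *: b + a by rewrite scaleN1r addrC.
    by rewrite form1_linr ?form1_linl//; try exact: form_domlin; ring.
  have -> : N (2^-1 *: a + 2^-1 *: b) = (N a + N b + B a b + B b a) / 4.
    rewrite form1_linr//; last exact: form_domlin.
    rewrite !form1_linl// !(form1_Zl 2^-1)// !(form1_Zr 2^-1)//.
    by field.
  by field.
have cauchyN n k : (n <= k)%N ->
    N (c n - c k) <= 2 * (I k - I n) + 2 * r n + 2 * r k.
  move=> nk; rewrite para//.
  have [Sn In] := cP n; have [Sk Ik] := cP k.
  (* By convexity the midpoint stays in [S n]. The distance between [c n] and [c k] is then bounded
     by an increment of the convergent sequence [I]. *)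
  have : I n <= N (2^-1 *: c n + 2^-1 *: c k).
    apply: IleN; have [_ inn en] := Sn; have [_ ikk ek] := Sdec _ _ nk _ Sk.
    have Dk2 := form_domZ 2^-1 _ (Dc k).
    split.
    - exact: form_domlin.
    - have := inner_ge0 (-1 *: c n + c k); rewrite !inner_sqr//.
      rewrite (innerC (c n) (2^-1 *: c k)) !(inner_Zl 2^-1)//.
      rewrite (innerC (c k) (2^-1 *: c k)) !(inner_Zl 2^-1)// (innerC (c n) (c k)).
      by lra.
    - by rewrite form1_linr// form1_Zr//; lra.
  by lra.
have [cc Dcc cccvg] : exists2 cc, D cc & (fun n => N (c n - cc)) @ \oo --> (0 : R).
  apply: complete => // eps eps0.
  have /cvgrPdist_le /(_ (eps / 16)) H := Icvg.
  have [|K _ HK] := H _; first by rewrite divr_gt0.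
  have [K' _ HK'] := rlt _ (divr_gt0 eps0 (ltr0n R 16)).
  exists (maxn K K') => n k.
  wlog nk : n k / (n <= k)%N => [hw|].
    have [nk|/ltnW kn] := leqP n k; first exact: hw.
    move=> nK kK; have -> : N (c n - c k) = N (c k - c n).
      by rewrite !para// [2^-1 *: c n + _]addrC [2 * N (c n) + _]addrC.
    exact: hw.
  rewrite !geq_max => /andP[nK nK'] /andP[kK kK'].
  have := cauchyN n k nk; have := HK n nK; have := HK k kK.
  have /= := HK' n nK'; have /= := HK' k kK'.
  rewrite !ler_norml; lra.
(* [c n] tends to 0 in L2 because of [r n], and to [cc] in the form norm, which dominates the L2
   norm. *)
have cc0 : inner m cc cc = 0.
  apply/eqP; rewrite eq_le inner_ge0 andbT; apply/ler_addgt0Pr => eps eps0.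
  rewrite add0r.
  have [K _ HK] := (cvgr_lt _ cccvg) (eps / 4) (divr_gt0 eps0 (ltr0n R 4)).
  have [K' _ HK'] := rlt _ (divr_gt0 eps0 (ltr0n R 4)).
  have /= h1 := HK _ (leq_maxl K K'); have /= h2 := HK' _ (leq_maxr K K').
  move: h1 h2; set n := maxn K K' => h1 h2.
  have [[_ cn _] _] := cP n.
  have := le_lt_trans (inner_le_form1 _ (form_domB _ _ (Dc n) Dcc)) h1.
  have -> : c n - cc = -1 *: cc + c n by rewrite scaleN1r addrC.
  have := inner_ge0 (-2 *: c n + cc); rewrite !inner_sqr// (innerC (c n) cc).
  by lra.
have Bcc : B u cc = 0.
  rewrite /Falpha inner0_form0// add0r mul1r; apply/eqP; rewrite -normr_eq0 eq_le normr_ge0 andbT.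
  apply/ler_addgt0Pr => eps eps0; rewrite add0r.
  have [delta d0 H] := inner_small u eps Du eps0.
  by apply: H => //; rewrite cc0 ltW.
(* Once the form norm of [c K - cc] is below [e / (2 C)], the sector condition bounds
   [B u (c K - cc)] by [e / 2]. This contradicts [B u cc = 0] and [e <= B u (c K)]. *)
pose C := Ks * Num.sqrt (N u) + 1.
have C0 : 0 < C by rewrite ltr_wpDl// mulr_ge0// ?sqrtr_ge0// ltW.
have eC : 0 < (e / (2 * C)) ^+ 2 by rewrite exprn_gt0// divr_gt0// mulr_gt0.
have [K _ /(_ K (leqnn K)) /= HK] := (cvgr_lt _ cccvg) _ eC.
have DK := form_domB _ _ (Dc K) Dcc.
have sq : Num.sqrt (N (c K - cc)) <= e / (2 * C).
  rewrite -[leRHS]ger0_norm ?divr_ge0 ?mulr_ge0 ?(ltW e0) ?(ltW C0)// -sqrtr_sqr.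
  by rewrite ler_sqrt ltW.
have [[_ _ eK] _] := cP K.
have := sector u (c K - cc) Du DK.
have -> : B u (c K - cc) = B u (c K).
  by rewrite -scaleN1r addrC form1_linr// Bcc; ring.
rewrite ger0_norm; last by rewrite (le_trans (ltW e0)).
have : Ks * Num.sqrt (N u) * Num.sqrt (N (c K - cc)) <= C * (e / (2 * C)).
  apply: ler_pM => //; rewrite ?sqrtr_ge0// ?mulr_ge0 ?sqrtr_ge0// ?(ltW Ks0)//.
  by rewrite /C lerDl.
have -> : C * (e / (2 * C)) = e / 2 by field; rewrite gt_eqF.
lra.
Qed.

Lemma form_small u (M e : R) : D u -> 0 < e -> exists2 delta, 0 < delta &
  forall d, D d -> N d <= M -> inner m d d <= delta -> `|F u d| <= e.
Proof.
move=> Du e0; have e20 : 0 < e / 2 by rewrite divr_gt0.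
have [d1 d10 H1] := form1_small u M _ Du e20.
have [d2 d20 H2] := inner_small u _ Du e20.
exists (Num.min d1 d2); first by rewrite lt_min d10.
move=> d Dd dM; rewrite le_min => /andP[dd1 dd2].
have -> : F u d = B u d - inner m u d by rewrite /Falpha; ring.
have := H1 d Dd dM dd1; have := H2 d Dd dd2; rewrite !ler_norml; lra.
Qed.

Variable Gh : R -> (E -> R) -> E -> R.
Hypothesis HG : coresolvent m D F Gh.

(** With the residual [d b = v - b Gh_b v], the resolvent equation turns the approximating form into
    [F u v - F u (d b)]. The residual is bounded in the form norm and tends to 0 in L2, so
    [form_small] removes the last term. *)
Lemma coresolvent_form_cvg u v : D u -> D v ->
  (fun b => b * (inner m v u - inner m (b *: Gh b v) u)) @ +oo --> F u v.
Proof.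
move=> Du Dv; have [_ _ _ _ [_ [Ks Ks0 sector] _ _]] := HF.
pose d b := v - b *: Gh b v.
have DG b : 0 < b -> D (b *: Gh b v).
  by move=> b0; apply: form_domZ; have [] := HG b b0 v (form_L2 _ Dv).
have Dd b : 0 < b -> D (d b) by move=> b0; apply: form_domB => //; exact: DG.
have key b w : 0 < b -> D w -> b * inner m w (d b) = F w v - F w (d b).
  move=> b0 Dw; have [DGv /(_ w Dw)] := HG b b0 v (form_L2 _ Dv).
  rewrite /Falpha /d => GE.
  have -> : v - b *: Gh b v = (- b) *: Gh b v + v by rewrite scaleNr addrC.
  rewrite form_linr// inner_linr// -GE; ring.
(* Put [w = d b] in [key] and apply the sector condition to [d b] and [v]. After Young's inequality,
   [2 <= b] absorbs the remaining L2 norm of [d b]. *)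
have bound b : 2 <= b -> N (d b) + (b - 1) * inner m (d b) (d b) <= (Ks ^+ 2 + 4) * N v.
  move=> b2; have b0 : 0 < b by lra.
  have Db := Dd b b0; have ky := key b (d b) b0 Db.
  have sec := sector _ _ Db Dv.
  have am := inner_amgm 2^-1 (d b) v _ Db Dv.
  have {}am : `|inner m (d b) v| <= 2^-1 * inner m (d b) (d b) + 2 * inner m v v.
    by rewrite -{2}(invrK 2); apply: am; rewrite invr_gt0.
  have s1 := sqr_sqrtr (form1_ge0 _ Db); have s2 := sqr_sqrtr (form1_ge0 _ Dv).
  have p1 := sqrtr_ge0 (N (d b)); have p2 := sqrtr_ge0 (N v).
  have iv := inner_le_form1 _ Dv; have i0 := inner_ge0 (d b).
  have arith (x y Nd Nv Bdv dv dd vv Fdv Fdd : R) : x ^+ 2 = Nd -> y ^+ 2 = Nv ->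
      `|Bdv| <= Ks * x * y -> `|dv| <= 2^-1 * dd + 2 * vv -> vv <= Nv -> 0 <= dd ->
      Nd = Fdd + 1 * dd -> Bdv = Fdv + 1 * dv -> b * dd = Fdv - Fdd ->
      Nd + (b - 1) * dd <= (Ks ^+ 2 + 4) * Nv.
    move=> <- <-; rewrite !ler_norml => /andP[_ h1] /andP[h2 _] h3 h4 h5 h6 h7.
    have h8 : 0 <= (x - Ks * y) ^+ 2 by exact: sqr_ge0.
    have h9 : 0 <= (b - 2) * dd by rewrite mulr_ge0// subr_ge0.
    have h10 : Ks * x * y <= (x ^+ 2 + Ks ^+ 2 * y ^+ 2) / 2 by move: h8; lra.
    by lra.
  exact: (arith _ _ _ _ _ _ _ _ _ _ s1 s2 sec am iv i0 erefl erefl ky).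
apply/cvgrPdist_le => e e0.
have Nv0 := form1_ge0 _ Dv.
have KN0 : 0 <= (Ks ^+ 2 + 4) * N v by rewrite mulr_ge0// addr_ge0 ?sqr_ge0.
have [delta de0 Hde] := form_small u ((Ks ^+ 2 + 4) * N v) e Du e0.
near=> b.
have b2 : 2 <= b by near: b; apply: nbhs_pinfty_ge; exact: num_real.
have b0 : 0 < b by lra.
have -> : b * (inner m v u - inner m (b *: Gh b v) u) = b * inner m u (d b).
  have -> : d b = -1 *: (b *: Gh b v) + v by rewrite scaleN1r addrC.
  have DGb := DG b b0.
  by rewrite inner_linr// (innerC v u) (innerC _ u); ring.
rewrite key// opprB addrC subrK; have bb := bound b b2.
have id0 := inner_ge0 (d b); have Nd0 := form1_ge0 _ (Dd b b0).
have bd0 : 0 <= (b - 1) * inner m (d b) (d b) by rewrite mulr_ge0//; lra.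
apply: Hde; [exact: Dd|by lra|].
have bdelta : (Ks ^+ 2 + 4) * N v / delta + 1 <= b.
  by near: b; apply: nbhs_pinfty_ge; exact: num_real.
have : (Ks ^+ 2 + 4) * N v <= (b - 1) * delta.
  by rewrite -ler_pdivrMr//; lra.
move=> h; have : (b - 1) * inner m (d b) (d b) <= (b - 1) * delta by lra.
by rewrite ler_pM2l//; lra.
Unshelve. all: by end_near.
Qed.

End FormConvergence.

(** * Topology of the product space and of its diagonal *)

HB.instance Definition _ (R : realType) (E : pmetricType R) :=
  PseudoMetric.on (E * E)%type.

Definition tensor {R : realType} {T : Type} (a b : T -> R) (p : T * T) : R :=
  a p.1 * b p.2.

Definition flip_pair {T : Type} (p : T * T) : T * T := (p.2, p.1).

Lemma funME {R : realType} {T : Type} (f g : T -> R) (x : T) :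
  (f * g) x = f x * g x.
Proof. by []. Qed.

Lemma near_eq_continuous {R : realType} {T : topologicalType} (f g : T -> R) (x : T) :
  (\forall z \near x, f z = g z) -> {for x, continuous f} -> {for x, continuous g}.
Proof.
move=> fg cf; have fgx := nbhs_singleton fg.
by rewrite /prop_for /continuous_at -fgx; apply: cvg_trans cf; exact: near_eq_cvg.
Qed.

Section MetricFacts.
Context {R : realType} {E : pmetricType R}.

Lemma continuous_rho : continuous (fun p : E * E => rho p.1 p.2 : R).
Proof.
move=> [x y]; apply/cvgrPdist_le => e e0.
have e20 : 0 < e / 2 by rewrite divr_gt0.
near=> p => /=.
have h1 : ball x (e / 2) p.1.
  by near: p; apply: (@cvg_fst _ _ (nbhs x) (nbhs y)); exact: nbhsx_ballx.
have h2 : ball y (e / 2) p.2.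
  by near: p; apply: (@cvg_snd _ _ (nbhs x) (nbhs y)); exact: nbhsx_ballx.
move: h1 h2; rewrite !ballEmdist /= => h1 h2.
have t1 := metric_triangle x p.1 y; have t2 := metric_triangle p.1 p.2 y.
have t3 := metric_triangle p.1 x p.2; have t4 := metric_triangle x y p.2.
rewrite (metric_sym p.2 y) in t2; rewrite (metric_sym p.1 x) in t3.
by rewrite /rho ler_norml; lra.
Unshelve. all: by end_near.
Qed.

Lemma continuous_rho_right (x : E) : continuous (fun y => rho x y : R).
Proof.
move=> y.
apply: (@continuous_comp _ _ _ (fun y => (x, y)) (fun p : E * E => rho p.1 p.2)).
  by apply: cvg_pair; [exact: cvg_cst|exact: cvg_id].
exact: continuous_rho.
Qed.

Lemma continuous_fst_comp {T : topologicalType} (f : E -> T) :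
  continuous f -> continuous (fun p : E * E => f p.1).
Proof.
by move=> cf p; apply: (@continuous_comp _ _ _ fst f p); [exact: cvg_fst|exact: cf].
Qed.

Lemma continuous_snd_comp {T : topologicalType} (f : E -> T) :
  continuous f -> continuous (fun p : E * E => f p.2).
Proof.
by move=> cf p; apply: (@continuous_comp _ _ _ snd f p); [exact: cvg_snd|exact: cf].
Qed.

Lemma open_rectangle (U V : set E) : open U -> open V -> open (U `*` V).
Proof.
move=> oU oV.
have /continuousP h1 := @continuous_fst_comp E id (fun x => cvg_id).
have /continuousP h2 := @continuous_snd_comp E id (fun x => cvg_id).
by have := openI (h1 _ oU) (h2 _ oV).
Qed.

Lemma continuous_tensor (a b : E -> R) : continuous a -> continuous b ->
  continuous (tensor a b).
Proof.
by move=> ca cb p; apply: cvgM;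
  [exact: continuous_fst_comp|exact: continuous_snd_comp].
Qed.

Lemma continuous_flip : continuous (@flip_pair E).
Proof. by move=> p; apply: cvg_pair => /=; [exact: cvg_snd|exact: cvg_fst]. Qed.

Lemma diagE_rho (p : E * E) : diagE p <-> rho p.1 p.2 = 0.
Proof.
split; first by rewrite /diagE/= => ->; exact: mdistxx.
exact: mdist_positivity.
Qed.

Lemma closed_diagE : closed (@diagE R E).
Proof.
have -> : @diagE R E = (fun p : E * E => rho p.1 p.2) @^-1` [set 0].
  by apply/seteqP; split => p /diagE_rho.
by have /continuous_closedP := continuous_rho; apply; exact: closed_eq.
Qed.

Lemma hausdorff_prod : hausdorff_space (E * E)%type.
Proof.
have hE := @metric_hausdorff _ E.
have n1 (x y : E) (A : set E) : nbhs x A -> nbhs (x, y) (A `*` setT).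
  by move=> nA; exists (A, setT) => //; split => //; exact: filterT.
have n2 (x y : E) (A : set E) : nbhs y A -> nbhs (x, y) (setT `*` A).
  by move=> nA; exists (setT, A) => //; split => //; exact: filterT.
move=> [x1 y1] [x2 y2] cl; congr pair; apply: hE => A B nA nB.
- have [p [[pA _] [pB _]]] := cl _ _ (n1 x1 y1 A nA) (n1 x2 y2 B nB).
  by exists p.1.
- have [p [[_ pA] [_ pB]]] := cl _ _ (n2 x1 y1 A nA) (n2 x2 y2 B nB).
  by exists p.2.
Qed.

(* A Lebesgue number for an open neighbourhood of the diagonal over K. *)
Lemma diag_uniform_nbhs (K : set E) (O : set (E * E)) : compact K -> open O ->
  (forall x, K x -> O (x, x)) ->
  exists2 delta : R, 0 < delta & forall x y, K x -> rho x y < delta -> O (x, y).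
Proof.
move=> /compact_near_coveringP cK oO KO.
have H : forall x, K x -> \forall x' \near x & e \near (0 : R)^'+,
    forall y, rho x' y < e -> O (x', y).
  move=> x Kx.
  have : nbhs (x, x) O by apply: open_nbhs_nbhs; split => //; exact: KO.
  move=> [[U V] /= [/nbhs_ballP[e1 e10 U1] /nbhs_ballP[e2 e20 V2]] UVO].
  have e220 : 0 < e2 / 2 by rewrite divr_gt0.
  near=> x' e => y xy; apply: UVO; split => /=.
  - by apply: U1; near: x'; exact: nbhsx_ballx.
  - apply: V2; have : ball x (e2 / 2) x' by near: x'; exact: nbhsx_ballx.
    rewrite !ballEmdist/= => h1.
    have h2 : e < e2 / 2 by near: e; exact: nbhs_right_lt.
    have := metric_triangle x x' y; move: xy; rewrite /rho/=; lra.
have := cK _ _ (fun e x => forall y, rho x y < e -> O (x, y)) _ H.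
move=> /(_ (at_right_proper_filter 0)) H'; near (0 : R)^'+ => e.
have e0 : 0 < e by near: e; exact: nbhs_right_gt.
exists e => // x y Kx xy.
exact: (near H' e _ x Kx y xy).
Unshelve. all: by end_near.
Qed.

End MetricFacts.

(** * Continuous functions with compact support *)

Section C0Facts.
Context {R : realType} {E : pmetricType R}.
Implicit Types f g : E -> R.

Lemma C0_supp0 f x : ~ supp f x -> f x = 0.
Proof.
move=> nfx; apply: contrapT => /eqP fx; apply: nfx.
exact: subset_closure.
Qed.

Lemma C0_bounded f : C0 f -> exists2 M, 0 <= M & forall x, `|f x| <= M.
Proof.
move=> [cf cs].
have : compact (f @` supp f).
  by apply: continuous_compact => //; exact: continuous_subspaceT.
move=> /compact_bounded [M [_ HM]].
exists (`|M| + 1); first by rewrite addr_ge0.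
move=> x; have [sx|/C0_supp0 ->] := pselect (supp f x); last by rewrite normr0 addr_ge0.
apply: (HM (`|M| + 1)); last by exists x.
by rewrite (le_lt_trans (ler_norm M))// ltrDl.
Qed.

Lemma C0_subsupp f g : C0 f -> continuous g -> (forall x, f x = 0 -> g x = 0) -> C0 g.
Proof.
move=> [cf cs] cg fg; split => //; apply: subclosed_compact cs _.
  exact: closed_closure.
by apply: closureS => x /=; apply: contraNN => /eqP /fg ->.
Qed.

Lemma C0_lin (k : R) f g : C0 f -> C0 g -> C0 (fun x => k * f x + g x).
Proof.
move=> [cf sf] [cg sg]; split.
  by move=> x; apply: cvgD; [apply: cvgMl_tmp; exact: cf|exact: cg].
apply: (@subclosed_compact _ _ (supp f `|` supp g)).
- exact: closed_closure.
- exact: compactU.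
- rewrite /supp -closureU; apply: closureS => x /= h.
  have [fx|fx] := eqVneq (f x) 0; last by left.
  by right => /=; move: h; rewrite fx mulr0 add0r.
Qed.

(** The Lebesgue number of the support settles pairs whose first point lies in it. Exchanging the
    points settles the second case, and [f] vanishes at both points otherwise. *)
Lemma C0_uniform f (e : R) : C0 f -> 0 < e ->
  exists2 delta : R, 0 < delta & forall x y, rho x y < delta -> `|f x - f y| <= e.
Proof.
move=> [cf sf] e0.
pose O := [set p : E * E | `|f p.1 - f p.2| < e].
have oO : open O.
  have cd : continuous (fun p : E * E => `|f p.1 - f p.2|).
    move=> p; apply: cvg_norm; apply: cvgB.
      exact: continuous_fst_comp.
    exact: continuous_snd_comp.
  by move/continuousP : cd => /(_ _ (@open_lt R e)).
have [x _|delta d0 H] := diag_uniform_nbhs (supp f) O sf oO.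
  by rewrite /O/= subrr normr0.
exists delta => // x y xy.
have [sx|nsx] := pselect (supp f x); first by apply: ltW; exact: (H x y).
have [sy|nsy] := pselect (supp f y).
  by rewrite distrC; apply: ltW; apply: (H y x) => //; rewrite /rho metric_sym.
by rewrite (C0_supp0 _ _ nsx) (C0_supp0 _ _ nsy) subrr normr0 ltW.
Qed.

End C0Facts.

(** * Exchange of coordinates in the jumping measure *)

Section FlippedMeasure.
Context {R : realType} {E : pmetricType R}.
Local Notation BEE := (borel (E * E)%type).
Variable J : {measure set BEE -> \bar R}.

Lemma measurable_flip : measurable_fun [set: BEE] (@flip_pair E : BEE -> BEE).
Proof.
apply: (@measurability _ _ BEE BEE _ _ (@open (E * E)%type) erefl).
move=> _ [A oA <-]; rewrite setTI; apply: borel_open.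
by have /continuousP := @continuous_flip R E; apply.
Qed.

(** The co-resolvent kernels evaluate the second argument of the form at the first coordinate,
    whereas the jump integral evaluates it at the second. The vague limit is therefore this image of
    [J]. *)
Definition flip_measure : {measure set BEE -> \bar R} :=
  measure_function_pushforward__canonical__measure_function_Measure
    J measurable_flip.

Hypothesis J0 : J diagE = 0%E.

Lemma flip_measure_integral (q : E * E -> R) (r : R) :
  measurable_fun [set: BEE] (q : BEE -> R) ->
  has_integral J (~` diagE : set BEE) (fun p => q (p.2, p.1)) r ->
  has_integral flip_measure [set: BEE] q r.
Proof.
move=> mq [qi qr].
have mq' : measurable_fun [set: BEE] (fun p : BEE => q (p.2, p.1)).
  by apply: (measurableT_comp mq measurable_flip).
have mdiag : measurable (diagE : set BEE) by apply: borel_closed; exact: closed_diagE.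
have qi' : J.-integrable [set: BEE] (EFin \o (fun p : BEE => q (p.2, p.1))).
  apply/(negligible_integrable mdiag measurableT _ J0); last by rewrite setTD.
  exact/measurable_EFinP.
have mq2 : measurable_fun [set: BEE] (EFin \o (q : BEE -> R)).
  exact/measurable_EFinP.
split.
- exact: (integrable_pushforward measurable_flip).
- rewrite /Rintegral (integral_pushforward measurable_flip mq2)//.
  rewrite preimage_setT -qr /Rintegral; congr fine.
  by rewrite (negligible_integral mdiag measurableT qi' J0) setTD.
Qed.

End FlippedMeasure.

(** * Uniqueness of signed Radon measures *)

Section SignedUniqueness.
Context {R : realType} {E : pmetricType R}.
Local Notation BE := (borel E).

Definition tame (q : E -> R) : Prop :=
  measurable_fun [set: BE] (q : BE -> R) /\
  exists K M, [/\ compact K, (forall x, ~ K x -> q x = 0) & (forall x, `|q x| <= M)].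

(** This is what is retained of a signed Radon measure: linearity, and bounded convergence over a
    fixed compact set. Differences of positive Radon measures have both properties, even when the
    two total masses are infinite. *)
Definition tame_functional (L : (E -> R) -> R) : Prop :=
  (forall k q1 q2, tame q1 -> tame q2 ->
     L (fun x => k * q1 x + q2 x) = k * L q1 + L q2) /\
  (forall (qn : nat -> E -> R) q K M, compact K ->
     (forall n, measurable_fun [set: BE] (qn n : BE -> R)) ->
     measurable_fun [set: BE] (q : BE -> R) ->
     (forall n x, `|qn n x| <= M) -> (forall n x, ~ K x -> qn n x = 0) ->
     (forall x, qn n x @[n --> \oo] --> q x) ->
     L (qn n) @[n --> \oo] --> L q).

Lemma tame_integrable (mu : {measure set BE -> \bar R}) (w q : E -> R) (Mw : R) :
  radonE mu -> continuous w -> (forall x, `|w x| <= Mw) -> tame q ->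
  mu.-integrable [set: BE] (EFin \o (fun x => q x * w x)).
Proof.
move=> rmu cw wM [mq [K [M [cK qK qM]]]].
apply: (@integrable_mul_bounded _ _ _ mu _ measurableT q w Mw) => //.
  exact: borel_continuous.
apply: (@integrable_compact_support _ _ _ _ K M) => //; last exact: rmu.
by apply: borel_closed; apply: compact_closed => //; exact: metric_hausdorff.
Qed.

Lemma tame_functional_weighted (mu : {measure set BE -> \bar R}) (w : E -> R) (Mw : R) :
  radonE mu -> continuous w -> (forall x, `|w x| <= Mw) ->
  tame_functional (fun q => \int[mu]_(x in [set: BE]) (q x * w x)).
Proof.
move=> rmu cw wM; split.
- move=> k q1 q2 t1 t2.
  have i1 := tame_integrable _ _ _ _ rmu cw wM t1.
  have i2 := tame_integrable _ _ _ _ rmu cw wM t2.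
  have [_ <-] := has_integralD _ _ measurableT _ _ _ _
    (has_integralZ _ _ measurableT k _ _ (has_integral_intro _ _ _ i1))
    (has_integral_intro _ _ _ i2).
  by apply: eq_Rintegral => x _; ring.
- move=> qn q K M cK mqn mq qM qK qnq.
  have mw := borel_continuous _ cw.
  have mK : measurable (K : set BE).
    by apply: borel_closed; apply: compact_closed => //; exact: metric_hausdorff.
  have M0 : 0 <= M by apply: le_trans (qM 0%N point); exact: normr_ge0.
  have Mw0 : 0 <= Mw by apply: le_trans (wM point); exact: normr_ge0.
  have gi : mu.-integrable [set: BE] (EFin \o (fun x => M * Mw * \1_K x)).
    apply: (@integrable_compact_support _ _ _ _ K (M * Mw)) => //; first exact: rmu.
    + by apply: measurable_funM => //; exact: measurable_indic.
    + move=> x; rewrite normrM (ger0_norm (mulr_ge0 M0 Mw0)) indicE ler_piMr ?mulr_ge0//.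
      by case: (_ \in _); rewrite ?normr1 ?normr0.
    + by move=> x nKx; rewrite indicE memNset// mulr0.
  have [//||||_ h] := @Rintegral_dominated_cvg _ _ _ mu _ measurableT
    (fun n x => qn n x * w x) (fun x => q x * w x) _ _ _ gi.
  + by move=> n; exact: measurable_funM.
  + exact: measurable_funM.
  + move=> n x _; rewrite indicE; have [Kx|nKx] := pselect (K x).
      by rewrite mem_set// mulr1 normrM ler_pM.
    by rewrite qK// mul0r normr0 memNset// mulr0.
  + by move=> x _; apply: cvgMr_tmp; exact: qnq.
  exact: h.
Qed.

Lemma tame_functionalB (L1 L2 : (E -> R) -> R) :
  tame_functional L1 -> tame_functional L2 ->
  tame_functional (fun q => L1 q - L2 q).
Proof.
move=> [l1 c1] [l2 c2]; split.
- by move=> k q1 q2 t1 t2; rewrite l1// l2//; ring.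
- move=> qn q K M cK mqn mq qM qK qnq.
  by apply: cvgB; [exact: (c1 _ _ K M)|exact: (c2 _ _ K M)].
Qed.

Lemma tame_indic (S B : set E) : measurable (S : set BE) -> compact B ->
  tame (\1_(S `&` B) : E -> R).
Proof.
move=> mS cB; split.
  apply: measurable_indic; apply: measurableI => //.
  by apply: borel_closed; apply: compact_closed => //; exact: metric_hausdorff.
exists B, 1; split => // x.
  by move=> nBx; rewrite indicE memNset// => -[].
by rewrite indicE; case: (_ \in _); rewrite ?normr1 ?normr0.
Qed.

(** Bump sequences give the value 0 on indicators of compact sets. The Borel sets whose trace on the
    compact closure [B] of [A] has value 0 then form a Dynkin class containing the open sets. *)
Lemma tame_functional_eq0 (T : set (E -> R)) (L : (E -> R) -> R) :
  bump_algebra T [set: E] -> (forall f, T f -> C0 f) ->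
  tame_functional L -> (forall f, T f -> L f = 0) ->
  forall A : set E, measurable (A : set BE) -> compact (closure A) ->
  L (\1_A) = 0.
Proof.
move=> bT TC [Llin Lcvg] LT A mA cB; set B := closure A in cB.
have hE := @metric_hausdorff _ E.
have mcpt (C : set E) : compact C -> measurable (C : set BE).
  by move=> cC; apply: borel_closed; exact: compact_closed.
have Lcpt (C : set E) : compact C -> L (\1_C) = 0.
  move=> cC.
  have [a0 [an [a0P anP an0 anC]]] := bump_sequence _ _ _ hE bT cC (@subsetT _ _).
  have [Ta0 a001 _ _] := a0P; have [ca0 sa0] := TC _ Ta0.
  have an01 n x : 0 <= an n x <= 1 by have [_ h _ _] := anP n.
  have := Lcvg an (\1_C) (supp a0) 1 sa0.
  move=> H; have {}H : L (an n) @[n --> \oo] --> L (\1_C).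
    apply: H.
    - by move=> n; apply: borel_continuous; have [/TC[]] := anP n.
    - by apply: measurable_indic; exact: mcpt.
    - by move=> n x; have /andP[? ?] := an01 n x; rewrite ger0_norm.
    - move=> n x /C0_supp0 h; apply/eqP; rewrite eq_le; have /andP[-> _] := an01 n x.
      by rewrite andbT -h an0.
    - move=> x; rewrite indicE; have [Cx|nCx] := pselect (C x).
        rewrite mem_set//; apply: cvg_near_cst; apply: nearW => n.
        by have [_ _ aC _] := anP n; rewrite (nbhs_singleton (aC x Cx)).
      by rewrite memNset//; apply: cvg_near_cst; exact: anC.
  apply: (cvg_unique (@norm_hausdorff _ R^o) H).
  by apply: cvg_near_cst; apply: nearW => n; apply: LT; have [] := anP n.
have LD (S1 S2 : set E) (k : R) : measurable (S1 : set BE) -> measurable (S2 : set BE) ->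
    L (fun x => k * \1_(S1 `&` B) x + \1_(S2 `&` B) x) =
    k * L (\1_(S1 `&` B)) + L (\1_(S2 `&` B)).
  by move=> m1 m2; apply: Llin; exact: tame_indic.
have LB : L (\1_([set: E] `&` B)) = 0 by rewrite setTI Lcpt.
have LC (S : set E) : measurable (S : set BE) -> L (\1_(S `&` B)) = 0 ->
    L (\1_(~` S `&` B)) = 0.
  move=> mS LS.
  have -> : \1_(~` S `&` B) = (fun x => -1 * \1_(S `&` B) x + \1_([set: E] `&` B) x) :> (E -> R).
    apply/funext => x; rewrite !indicE setTI.
    have [Bx|nBx] := pselect (B x); last first.
      by rewrite !memNset// ?mulr0 ?addr0//; move=> -[].
    rewrite (mem_set Bx); have [Sx|nSx] := pselect (S x).
      rewrite memNset; last by move=> -[].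
      by rewrite mem_set//= mulr1 addNr.
    rewrite mem_set//; rewrite memNset; last by move=> -[].
    by rewrite /= mulr0 add0r.
  by rewrite LD// LS LB; ring.
have LU (S1 S2 : set E) : measurable (S1 : set BE) -> measurable (S2 : set BE) ->
    S1 `&` S2 = set0 ->
    L (\1_(S1 `&` B)) = 0 -> L (\1_(S2 `&` B)) = 0 -> L (\1_((S1 `|` S2) `&` B)) = 0.
  move=> m1 m2 dis L1 L2.
  have -> : \1_((S1 `|` S2) `&` B) = (fun x => 1 * \1_(S1 `&` B) x + \1_(S2 `&` B) x) :> (E -> R).
    apply/funext => x; rewrite !indicE !in_setI in_setU mul1r.
    have : ~ (S1 x /\ S2 x) by move=> h; rewrite -[False]/(set0 x) -dis.
    have [S1x|nS1x] := pselect (S1 x); have [S2x|nS2x] := pselect (S2 x) => h;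
      rewrite ?(mem_set S1x) ?(mem_set S2x) ?(memNset nS1x) ?(memNset nS2x) /=;
      rewrite ?addr0 ?add0r//.
    by exfalso; apply: h.
  by rewrite LD// L1 L2; ring.
suff : L (\1_(A `&` B)) = 0 by rewrite (setIidl (@subset_closure _ A)).
apply: (@dynkin_induction _ BE (@open E) (fun S => L (\1_(S `&` B)) = 0) erefl
  _ LB _ _ _ A mA).
- by move=> O1 O2; exact: openI.
(* The complement of an open set has a compact trace on [B]. *)
- move=> U oU; rewrite -[U]setCK; apply: LC.
    by apply: borel_closed; exact: open_closedC.
  by rewrite setIC; apply: Lcpt; apply: compact_closedI => //; exact: open_closedC.
- exact: LC.
- move=> Fn mF tF PF.
  (* Additivity handles the finite unions; at each point their indicators are eventually constant,
     so bounded convergence reaches the countable union. *)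
  pose U n := \big[setU/set0]_(k < n) Fn k.
  have mU n : measurable (U n : set BE) by apply: bigsetU_measurable => k _; exact: mF.
  have LUn n : L (\1_(U n `&` B)) = 0.
    elim: n => [|n IH].
      by rewrite /U big_ord0 set0I; apply: Lcpt; exact: compact0.
    rewrite /U big_ord_recr/=; apply: (LU _ _ (mU n) (mF n) _ IH (PF n)).
    rewrite -subset0 => x []; rewrite /U -bigcup_mkord => -[k /= kn Fkx] Fnx.
    by move: kn; rewrite (tF k n I I) ?ltnn//; exists x.
  have lim0 : L (\1_(U n `&` B)) @[n --> \oo] --> (0 : R).
    by apply: cvg_near_cst; exact: nearW.
  apply: cvg_unique lim0; first exact: (@norm_hausdorff _ R^o).
  have mB : measurable (B : set BE) by exact: mcpt.
  apply: (Lcvg (fun n => \1_(U n `&` B)) _ B 1) => //.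
  + by move=> n; apply: measurable_indic; exact: measurableI.
  + by apply: measurable_indic; apply: measurableI => //; exact: bigcup_measurable.
  + by move=> n x; rewrite indicE; case: (_ \in _); rewrite ?normr1 ?normr0.
  + by move=> n x nBx; rewrite indicE memNset// => -[].
  + move=> x; apply: cvg_near_cst; rewrite indicE.
    have [[[k _ Fkx] Bx]|nUx] := pselect (((\bigcup_k Fn k) `&` B) x).
      rewrite mem_set; last by split => //; exists k.
      exists k.+1 => // n /= kn; rewrite indicE mem_set//; split => //.
      by rewrite /U -bigcup_mkord; exists k.
    rewrite memNset//; apply: nearW => n; rewrite indicE memNset// => -[].
    by rewrite /U -bigcup_mkord => -[k _ Fkx] Bx; apply: nUx; split => //; exists k.
Qed.

End SignedUniqueness.

(** * Test functions of the form and their bumps *)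

Section SettingConvergence.
Context {R : realType} {E : pmetricType R}.
Local Notation BE := (borel E).
Local Notation BEE := (borel (E * E)%type).
Variables (m : {measure set BE -> \bar R}) (D : set (E -> R)).
Variables (F : (E -> R) -> (E -> R) -> R) (Gh : R -> (E -> R) -> E -> R).
Variables (J : {measure set BEE -> \bar R}) (K : {measure set BE -> \bar R}).
Variables (sig : R -> {measure set BEE -> \bar R}).
Variables (Om : nat -> set E) (vs : nat -> R).
Hypothesis HS : setting m D F Gh J K sig Om vs.

Let HF : semi_dirichlet_form m D F. Proof. by case: HS => _ _ []. Qed.
Let HR : regular_form m D F. Proof. by case: HS => _ _ []. Qed.
Let HG : coresolvent m D F Gh. Proof. by case: HS => _ _ _ []. Qed.
Let Hsig : sigma_hat_of m Gh sig. Proof. by case: HS => _ _ _ []. Qed.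
Let HSA : standing_assumption D J. Proof. by case: HS => _ _ _ _ []. Qed.
Let HJK : jump_kill D F J K. Proof. by case: HS => _ _ _ _ []. Qed.
Let Hlc : locally_compact [set: E]. Proof. by case: HS => -[]. Qed.
Let Hm : radonE m. Proof. by case: HS => _ []. Qed.
Let J0 : J diagE = 0%E. Proof. by case: HJK => -[]. Qed.

Definition test_fun : set (E -> R) := [set f | C0 f /\ D f].

Lemma test_lin (k : R) f g : test_fun f -> test_fun g ->
  test_fun (fun x => k * f x + g x).
Proof.
move=> [Cf Df] [Cg Dg]; split; first exact: C0_lin.
exact: (form_domlin _ _ _ HF).
Qed.

Lemma test_mul f g : test_fun f -> test_fun g -> test_fun (f * g).
Proof. by move=> [Cf Df] [Cg Dg]; have [] := HSA f g Cf Df Cg Dg. Qed.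

Lemma test_continuous f : test_fun f -> continuous f.
Proof. by move=> [[]]. Qed.

(** The Markov property of the form keeps the unit truncation in the domain. *)
Lemma test_cut f : test_fun f ->
  test_fun (fun x => Num.min (Num.max (f x) 0) 1).
Proof.
move=> [Cf Df]; have [_ _ _ _ [_ _ _ h]] := HF; split; last by case: (h f Df).
apply: (C0_subsupp f) => //; last by move=> x ->; rewrite maxxx minEle ler01.
have [cf _] := Cf => x.
have c1 : {for x, continuous (fun x => Num.max (f x) 0)}.
  exact: (@continuous_max R E f (fun=> 0) x (cf x) (cvg_cst _)).
exact: (@continuous_min R E _ (fun=> 1) x c1 (cvg_cst _)).
Qed.

(** Regularity supplies a test function uniformly close to a tent; truncations then produce the
    exact values 0 and 1. *)
Lemma test_bump_algebra : bump_algebra test_fun [set: E].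
Proof.
split; first exact: openT.
- split; last by move=> f /test_continuous.
  split; last exact: (form_dom0 _ _ _ HF).
  split; first by move=> x; exact: cvg_cst.
  rewrite /supp [X in closure X](_ : _ = set0) ?closure0; first exact: compact0.
  by apply/seteqP; split => x //=; rewrite eqxx.
- exact: test_lin.
- exact: test_mul.
move=> O x oO Ox _.
have [U Ux [cU clU]] := Hlc x I.
have : nbhs x (U `&` O).
  apply: filterI; last by apply: open_nbhs_nbhs; split.
  by move: Ux; rewrite /within/=; apply: filterS => y; exact.
move=> /nbhs_ballP[e /= e0 eUO].
(* The tent has height 3 at [x] and vanishes from distance [e / 2] on. An approximation within 1/2
   exceeds 1 where [f > 3 / 2] and is below 1/2 where [f = 0]. *)
pose f y := Num.max (3 - (6 / e) * rho x y) 0.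
have cr := continuous_rho_right x.
have cf : continuous f.
  have c1 : continuous (fun y => 3 - (6 / e) * rho x y).
    by move=> y; apply: cvgB; [exact: cvg_cst|apply: cvgMl_tmp; exact: cr].
  by move=> y; exact: (@continuous_max R E _ (fun=> 0) y (c1 y) (cvg_cst _)).
have f_pos y : 0 < f y -> ball x e y.
  rewrite /f lt_max ltxx orbF ballEmdist /= subr_gt0 => h.
  have : 6 / e * rho x y < 6 by move: h; lra.
  by rewrite mulrAC ltr_pdivrMr// ltr_pM2l.
have f_ge0 y : 0 <= f y by rewrite /f le_max lexx orbT.
have Cf : C0 f.
  split => //; apply: (subclosed_compact _ cU); first exact: closed_closure.
  move/closure_id : clU => ->; apply: closureS => y /= fy.
  by have [] := eUO y (f_pos y _) ; rewrite ?lt_def ?fy ?f_ge0.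
have [_ /(_ f Cf 2^-1) [|g Tg fg]] := HR; first by rewrite invr_gt0.
have cg := test_continuous _ Tg.
(* As a function of [g] this is 0 for [g <= 1/2], 1 for [g >= 1] and affine in between. A difference
   of two truncations avoids subtracting a constant, which need not lie in the domain. *)
pose a y := (-1) * (Num.min (Num.max (2 * g y + 0) 0) 1) +
  (2 * (Num.min (Num.max (g y) 0) 1) + 0).
have T0 : test_fun (fun=> 0).
  have -> : (fun=> 0) = (fun y => (-1) * g y + g y) :> (E -> R).
    by apply/funext => y; ring.
  exact: test_lin.
exists a; split.
- apply: test_lin; first by apply: test_cut; exact: test_lin.
  by apply: test_lin => //; exact: test_cut.
- by move=> y; rewrite /a !minEle !maxEle; do ?case: ifP; lra.
- move=> _ ->.
  have f32 : \forall y \near x, 3 / 2 < f y.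
    apply: (cvgr_gt (f x) (cf x)).
    by rewrite /f /rho mdistxx mulr0 subr0 lt_max; apply/orP; left; lra.
  apply: filterS f32 => y fy; have := fg y; rewrite ltr_norml => /andP[h1 h2].
  by rewrite /a !minEle !maxEle; do ?case: ifP; lra.
- move=> y nOy.
  have fy : f y = 0.
    apply/eqP; rewrite eq_le f_ge0 andbT leNgt; apply/negP => /f_pos /eUO [_ Oy].
    exact: nOy.
  have := fg y; rewrite fy ltr_norml => /andP[h1 h2].
  by rewrite /a !minEle !maxEle; do ?case: ifP; lra.
Qed.

(** * The algebra generated by products with disjoint supports *)

Inductive offdiag_algebra : (E * E -> R) -> Prop :=
| offdiag_tensor a b : test_fun a -> test_fun b ->
    (forall x, supp a x -> ~ supp b x) -> offdiag_algebra (tensor a b)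
| offdiag_lin (k : R) f g : offdiag_algebra f -> offdiag_algebra g ->
    offdiag_algebra (fun p => k * f p + g p).

Lemma supp_mull (a b : E -> R) : supp (a * b) `<=` supp a.
Proof.
by apply: closureS => x /=; apply: contraNN => /eqP ax; rewrite /GRing.mul/= ax mul0r.
Qed.

Lemma offdiag_mul f g : offdiag_algebra f -> offdiag_algebra g ->
  offdiag_algebra (fun p => f p * g p).
Proof.
move=> Of Og; elim: Of g Og => {f} [a b Ta Tb ab g|k f1 f2 O1 I1 O2 I2 g Og].
  elim=> {g} [a' b' Ta' Tb' _|k g1 g2 O1 I1 O2 I2].
    have -> : (fun p => tensor a b p * tensor a' b' p) = tensor (a * a') (b * b').
      by apply/funext => p; rewrite /tensor mulrACA.
    apply: offdiag_tensor; try exact: test_mul.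
    by move=> x /supp_mull ax /supp_mull; exact: ab.
  have -> : (fun p => tensor a b p * (k * g1 p + g2 p)) =
            (fun p => k * (tensor a b p * g1 p) + tensor a b p * g2 p).
    by apply/funext => p; ring.
  exact: offdiag_lin.
have -> : (fun p => (k * f1 p + f2 p) * g p) =
          (fun p => k * (f1 p * g p) + f2 p * g p).
  by apply/funext => p; ring.
by apply: offdiag_lin; [exact: I1|exact: I2].
Qed.

(** At an off-diagonal point [(x, y)], multiply a bump at [x] by a bump at [y], each living within a
    third of the distance [rho x y]; the triangle inequality separates their supports. *)
Lemma offdiag_bump_algebra : bump_algebra offdiag_algebra (~` @diagE R E).
Proof.
split.
- by apply: closed_openC; exact: closed_diagE.
- split.
    have [_ [T0 _] _ _ _] := test_bump_algebra.
    have -> : (fun=> 0) = tensor (fun=> 0) (fun=> 0) :> (E * E -> R).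
      by apply/funext => p; rewrite /tensor mul0r.
    apply: offdiag_tensor => // x; rewrite /supp [X in closure X](_ : _ = set0) ?closure0//.
    by apply/seteqP; split => y //=; rewrite eqxx.
  move=> f; elim=> {f} [a b Ta Tb _|k f g _ cf _ cg].
    by apply: continuous_tensor; exact: test_continuous.
  by move=> p; apply: cvgD; [apply: cvgMl_tmp; exact: cf|exact: cg].
- exact: offdiag_lin.
- exact: offdiag_mul.
move=> O [x y] oO Oxy OW.
have r0 : 0 < rho x y / 3.
  rewrite divr_gt0// /rho mdist_gt0; apply/eqP => xy; exact: (OW _ Oxy).
have : nbhs (x, y) O by apply: open_nbhs_nbhs; split.
move=> [[U V] /= [nU nV] UVO].
have [_ _ _ _ loc] := test_bump_algebra.
have op z : open [set w : E | rho z w < rho x y / 3].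
  have /continuousP := continuous_rho_right z.
  by move=> /(_ _ (@open_lt R (rho x y / 3))).
have cl z : closed [set w : E | rho z w <= rho x y / 3].
  have /continuous_closedP := continuous_rho_right z.
  by move=> /(_ _ (@closed_le R (rho x y / 3))).
have [||//|a [Ta a01 ax aO]] := loc (U° `&` [set w | rho x w < rho x y / 3]) x.
- by apply: openI => //; exact: open_interior.
- by split => //=; rewrite {1}/rho mdistxx.
have [||//|b [Tb b01 bx bO]] := loc (V° `&` [set w | rho y w < rho x y / 3]) y.
- by apply: openI => //; exact: open_interior.
- by split => //=; rewrite {1}/rho mdistxx.
have suppb (z : E) (W : set E) (c : E -> R) :
    (forall w, ~ (W° `&` [set w | rho z w < rho x y / 3]) w -> c w = 0) ->
    supp c `<=` [set w | rho z w <= rho x y / 3].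
  move=> cO; rewrite [X in _ `<=` X](closure_id _).1//; apply: closureS => w /= cw.
  by apply/ltW; apply: contrapT => h; move/eqP: cw; apply; apply: cO => -[_ /=].
exists (tensor a b); split.
- apply: offdiag_tensor => // w /(suppb x U a aO) /= h1 /(suppb y V b bO) /= h2.
  have := metric_triangle x w y; rewrite (metric_sym w y); move: h1 h2 r0.
  by rewrite /rho; lra.
- by move=> p; have := a01 p.1; have := b01 p.2; rewrite /tensor; nra.
- move=> _ ->; near=> p; rewrite /tensor.
  have -> : a p.1 = 1.
    by near: p; apply: (@cvg_fst _ _ (nbhs x) (nbhs y) _ [set z | a z = 1]); exact: ax.
  have -> : b p.2 = 1.
    by near: p; apply: (@cvg_snd _ _ (nbhs x) (nbhs y) _ [set z | b z = 1]); exact: bx.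
  by rewrite mulr1.
- move=> p nOp; rewrite /tensor; have [Up|nUp] := pselect (U p.1).
    rewrite bO ?mulr0// => -[/interior_subset Vp _]; apply: nOp.
    by apply: UVO.
  by rewrite aO ?mul0r// => -[/interior_subset].
Unshelve. all: by end_near.
Qed.

(** * Limits of integrals against the co-resolvent kernels *)

Lemma tensor_sig_integrable a b (t : R) : 0 < t -> C0 a -> C0 b ->
  (sig t).-integrable [set: BEE] (EFin \o tensor a b).
Proof.
move=> t0 Ca Cb; have [rad _] := Hsig t t0.
have [Ma Ma0 aM] := C0_bounded _ Ca; have [Mb Mb0 bM] := C0_bounded _ Cb.
have cC : compact (supp a `*` supp b) by apply: compact_setX; [case: Ca|case: Cb].
apply: (@integrable_compact_support _ _ _ _ (supp a `*` supp b) (Ma * Mb)).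
- by apply: borel_closed; exact: compact_closed hausdorff_prod cC.
- exact: rad.
- by apply: borel_continuous; apply: continuous_tensor; [case: Ca|case: Cb].
- by move=> p; rewrite /tensor normrM ler_pM.
- move=> p np; rewrite /tensor; have [ap|/C0_supp0 ->] := pselect (supp a p.1); last by rewrite mul0r.
  by rewrite (C0_supp0 b) ?mulr0// => bp; apply: np.
Qed.

Lemma C0_m_integrable f : C0 f -> m.-integrable [set: BE] (EFin \o f).
Proof.
move=> Cf; have [M M0 fM] := C0_bounded _ Cf; have [cf sf] := Cf.
apply: (@integrable_compact_support _ _ _ _ (supp f) M) => //.
- by apply: borel_closed; exact: closed_closure.
- exact: Hm.
- exact: borel_continuous.
- exact: C0_supp0.
Qed.

(* The value e of the form on a combination H of tensors, where h is the
   restriction of H to the diagonal. *)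
Definition form_limit (H : E * E -> R) (h : E -> R) (e : R) : Prop :=
  [/\ continuous H, (forall t : R, 0 < t -> (sig t).-integrable [set: BEE] (EFin \o H)),
      m.-integrable [set: BE] (EFin \o h) &
      (fun t => t * (\int[m]_(x in [set: BE]) h x - \int[sig t]_(p in [set: BEE]) H p))
        @ +oo --> e].

Let near_pos : \forall t \near (+oo : set_system R), 0 < t.
Proof. exact: nbhs_pinfty_gt. Qed.

(** The co-resolvent acts on the function of the first coordinate, which becomes the second argument
    of the form; hence the order [F b a]. *)
Lemma form_limit_tensor a b : test_fun a -> test_fun b ->
  form_limit (tensor a b) (a * b) (F b a).
Proof.
move=> Ta Tb; have [Ca Da] := Ta; have [Cb Db] := Tb; split.
- by apply: continuous_tensor; exact: test_continuous.
- by move=> t t0; exact: tensor_sig_integrable.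
- by apply: C0_m_integrable; case: (test_mul _ _ Ta Tb).
- apply: cvg_trans (coresolvent_form_cvg _ _ _ HF _ HG b a Db Da).
  apply: near_eq_cvg; near=> t.
  have t0 : 0 < t by near: t.
  by have [_ /(_ a b Ca Cb) ->] := Hsig t t0.
Unshelve. all: by end_near.
Qed.

Lemma form_limit_lin (k : R) H1 H2 h1 h2 (e1 e2 : R) :
  form_limit H1 h1 e1 -> form_limit H2 h2 e2 ->
  form_limit (fun p => k * H1 p + H2 p) (fun x => k * h1 x + h2 x) (k * e1 + e2).
Proof.
move=> [c1 s1 i1 l1] [c2 s2 i2 l2].
have I1 := has_integralD m _ measurableT _ _ _ _
  (has_integralZ m _ measurableT k _ _ (has_integral_intro _ _ _ i1))
  (has_integral_intro _ _ _ i2).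
have I2 t (t0 : 0 < t) := has_integralD (sig t) _ measurableT _ _ _ _
  (has_integralZ (sig t) _ measurableT k _ _ (has_integral_intro _ _ _ (s1 t t0)))
  (has_integral_intro _ _ _ (s2 t t0)).
split.
- by move=> p; apply: cvgD; [apply: cvgMl_tmp; exact: c1|exact: c2].
- by move=> t t0; have [] := I2 t t0.
- by have [] := I1.
- apply: cvg_trans (cvgD (cvgMl_tmp (a := k) l1) l2).
  apply: near_eq_cvg; near=> t.
  have t0 : 0 < t by near: t.
  have [_ ->] := I1; have [_ ->] := I2 t t0.
  by rewrite opprD addrACA mulrDr -mulrBr (mulrCA t).
Unshelve. all: by end_near.
Qed.

Lemma form_limit_eq H H' h h' (e e' : R) : form_limit H h e ->
  H =1 H' -> h =1 h' -> e = e' -> form_limit H' h' e'.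
Proof. by move=> HL /funext <- /funext <- <-. Qed.

(** * Kernels governed by the jumping measure alone *)

Local Notation nu := (flip_measure J).
Local Notation c := (fun t : R => t / 2).
Local Notation Jint := (has_integral J (~` diagE : set BEE)).

Let mW : measurable (~` diagE : set BEE).
Proof. by apply: measurableC; apply: borel_closed; exact: closed_diagE. Qed.

Lemma jump_integrable a b (B : E * E -> R) (M : R) : test_fun a -> test_fun b ->
  continuous B -> (forall p, `|B p| <= M) ->
  J.-integrable (~` diagE : set BEE)
    (EFin \o (fun p : BEE => (a p.2 - a p.1) * b p.2 * B p)).
Proof.
move=> [Ca Da] [Cb Db] cB BM; have [_ i] := HSA a b Ca Da Cb Db.
apply: (integrable_mul_bounded _ _ mW (fun p : BEE => (a p.2 - a p.1) * b p.2) B M) => //.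
by apply: measurable_funS (borel_continuous _ cB).
Qed.

Lemma form_limit_half H h (e : R) : (forall x, h x = 0) -> form_limit H h e ->
  (fun t => t / 2 * \int[sig t]_(p in [set: BEE]) H p) @ +oo --> - 2^-1 * e.
Proof.
move=> h0 [_ _ _ lH]; apply: cvg_trans (cvgMl_tmp (a := - 2^-1) lH).
apply: near_eq_cvg; apply: nearW => t /=.
rewrite [X in X - _](_ : _ = 0); last first.
  by under eq_Rintegral do rewrite h0; rewrite Rintegral_cst// mul0r.
by field.
Qed.

(** In [- 2 * r], the sign is that of the kernel integral in [form_limit], and the 2 is the
    normalisation of [J] in the form. *)
Lemma form_limit_vague H h (e r : R) : (forall x, h x = 0) -> form_limit H h e ->
  Jint (fun p => H (p.2, p.1)) r -> e = - 2 * r -> vague_cvg c sig nu H.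
Proof.
move=> h0 LH HJ er; have [cH iH _ _] := LH.
have mH := borel_continuous _ cH.
have [nH nr] := flip_measure_integral J J0 H r mH HJ.
split => //; rewrite nr.
have -> : r = - 2^-1 * e by rewrite er; field.
exact: form_limit_half LH.
Qed.

(** For disjoint supports the formula defining [J] and [K] applies: the killing term vanishes and
    only the product [b(x) a(y)] survives in the jump integral. *)
Lemma offdiag_vague f : offdiag_algebra f -> vague_cvg c sig nu f.
Proof.
elim=> {f} [a b Ta Tb ab|k f g _ If _ Ig]; last exact: vague_cvg_lin.
have ab0 x : a x * b x = 0.
  have [/ab nb|/C0_supp0 ->] := pselect (supp a x); last by rewrite mul0r.
  by rewrite (C0_supp0 b)// mulr0.
have [Ca Da] := Ta; have [Cb Db] := Tb.
have [_ i] := HSA b a Cb Db Ca Da.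
have JI := has_integralZ _ _ mW (-1) _ _
  (has_integral_intro _ _ (fun p : BEE => (b p.2 - b p.1) * a p.2) i).
have JI' : Jint (fun p => tensor a b (p.2, p.1))
    (-1 * \int[J]_(p in (~` diagE : set BEE)) ((b p.2 - b p.1) * a p.2)).
  apply: has_integral_ext JI => // p _; rewrite /tensor/= mulrBl.
  by rewrite (mulrC (b p.2)) ab0; ring.
apply: (form_limit_vague _ _ _ _ _ (form_limit_tensor _ _ Ta Tb) JI') => //.
have [_ [_ /(_ b a Cb Db Ca Da)]] := HJK; move=> ->; last first.
  (* [b] is constant, equal to 0, on the complement of its support, which is open and contains
     [supp a]. *)
  exists (~` supp b), 0; split; first by apply: closed_openC; exact: closed_closure.
  by split => // x; exact: C0_supp0.
rewrite [X in _ + X = _](_ : _ = 0); last first.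
  by under eq_Rintegral do rewrite mulrC ab0; rewrite Rintegral_cst// mul0r.
rewrite addr0.
have -> : - 2 * (-1 * \int[J]_(x in (~` diagE : set BEE)) ((b x.2 - b x.1) * a x.2)) =
   2 * \int[J]_(x in (~` diagE : set BEE)) ((b x.2 - b x.1) * a x.2) by ring.
have [_ <-] := has_integralZ _ _ mW 2 _ _
  (has_integral_intro _ _ (fun p : BEE => (b p.2 - b p.1) * a p.2) i).
by apply: eq_Rintegral => p _; rewrite mulrA.
Qed.

Let c_ge0 (t : R) : 0 < t -> 0 <= c t.
Proof. by move=> t0; rewrite divr_ge0// ltW. Qed.

(** The kernel [Q] has convergent weighted integrals and dominates [H] near the diagonal with an
    arbitrarily small factor. Cutting [H] off near the diagonal leaves a continuous kernel with
    compact support off it, where vague convergence is known; what is removed is at most a small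
    multiple of [Q]. *)
Lemma form_limit_jump H h Q hQ (e eQ r : R) (C : set (E * E)) (M : R) :
  (forall x, h x = 0) -> form_limit H h e ->
  compact C -> (forall p, ~ C p -> H p = 0) -> (forall p, `|H p| <= M) ->
  (forall x, hQ x = 0) -> form_limit Q hQ eQ ->
  nu.-integrable [set: BEE] (EFin \o Q) -> (forall p, 0 <= Q p) ->
  (forall e', 0 < e' -> exists2 d : R, 0 < d &
     forall p, rho p.1 p.2 < d -> `|H p| <= e' * Q p) ->
  Jint (fun p => H (p.2, p.1)) r -> e = - 2 * r.
Proof.
move=> h0 LH cC HC HM hQ0 LQ nQ Q0 small HJ.
have [cH iH _ _] := LH; have [cQ iQ _ _] := LQ.
have mH := borel_continuous _ cH.
have [nH <-] := flip_measure_integral J J0 H r mH HJ.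
have lH' := form_limit_half _ _ _ h0 LH; have lQ' := form_limit_half _ _ _ hQ0 LQ.
have [_ _ _ vH] : vague_cvg c sig nu H; last first.
  by rewrite -(cvg_unique (@norm_hausdorff _ R^o) lH' vH); field.
apply: vague_cvg_squeeze => // eps eps0.
set I := \int[nu]_(p in [set: BEE]) Q p.
have I0 : 0 <= I by apply: Rintegral_ge0.
(* The denominator bounds the integral of [Q] under [nu] and, eventually, its weighted integrals,
   which tend to [- eQ / 2]. *)
pose e' := eps / (I + `|eQ| + 1).
have den0 : 0 < I + `|eQ| + 1 by rewrite ltr_wpDl// addr_ge0.
have e'0 : 0 < e' by rewrite divr_gt0.
have e'E : e' * (I + `|eQ| + 1) = eps by rewrite /e' mulrVK// unitfE gt_eqF.
have [d d0 Hd] := small e' e'0.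
(* The cutoff is 0 where [rho < d / 2] and 1 where [rho >= d]. *)
pose k (p : E * E) := Num.min (Num.max (2 / d * rho p.1 p.2 - 1) 0) 1.
have ck : continuous k.
  move=> p.
  have c1 : {for p, continuous (fun p : E * E => 2 / d * rho p.1 p.2 - 1)}.
    by apply: cvgB; [apply: cvgMl_tmp; exact: continuous_rho|exact: cvg_cst].
  have c2 : {for p, continuous (fun p : E * E => Num.max (2 / d * rho p.1 p.2 - 1) 0)}.
    exact: (@continuous_max R _ _ (fun=> 0) p c1 (cvg_cst _)).
  exact: (@continuous_min R _ _ (fun=> 1) p c2 (cvg_cst _)).
have k01 p : 0 <= k p <= 1.
  by rewrite /k minEle maxEle; do ?case: ifP; lra.
have k0 p : rho p.1 p.2 < d / 2 -> k p = 0.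
  move=> dp; have : 2 / d * rho p.1 p.2 <= 1.
    by rewrite mulrAC ler_pdivrMr// mul1r; lra.
  by rewrite /k minEle maxEle; do ?case: ifP; lra.
have k1 p : d <= rho p.1 p.2 -> k p = 1.
  move=> dp; have : 2 <= 2 / d * rho p.1 p.2.
    by rewrite mulrAC ler_pdivlMr// ler_pM2l.
  by rewrite /k minEle maxEle; do ?case: ifP; lra.
have IQ (mu : {measure set BEE -> \bar R})
    (i : mu.-integrable [set: BEE] (EFin \o Q)) :=
  has_integralZ mu _ measurableT e' _ _ (has_integral_intro _ _ _ i).
exists (fun p => H p * k p), (fun p => e' * Q p); split.
- apply: (vague_cvg_continuous c sig nu c_ge0 _ _ offdiag_bump_algebra offdiag_vague
            _ (C `&` [set p | d / 2 <= rho p.1 p.2]) M).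
  + apply: compact_closedI => //.
    by have /continuous_closedP := @continuous_rho R E; move=> /(_ _ (@closed_ge R (d / 2))).
  + by move=> p [_ /= dp] /diagE_rho p0; move: dp; rewrite p0; lra.
  + by move=> p; apply: cvgM; [exact: cH|exact: ck].
  + move=> p; rewrite normrM -[leRHS]mulr1 ler_pM//.
    by have /andP[? ?] := k01 p; rewrite ger0_norm.
  + move=> p nCp; have [Cp|/HC ->] := pselect (C p); last by rewrite mul0r.
    rewrite k0 ?mulr0// ltNge; apply/negP => dp; exact: nCp.
- move=> p; have [dp|dp] := ltP (rho p.1 p.2) d; last first.
    by rewrite k1// mulr1 subrr normr0 mulr_ge0// ltW.
  have := Hd p dp; apply: le_trans.
  rewrite -{1}[H p]mulr1 -mulrBr normrM ler_piMr//.
  by have /andP[? ?] := k01 p; rewrite ger0_norm; lra.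
- by split; [move=> t t0; have [] := IQ _ (iQ t t0)|have [] := IQ _ nQ].
- have : \forall t \near (+oo : set_system R), t / 2 * \int[sig t]_(p in [set: BEE]) Q p < I + `|eQ| + 1.
    apply: (cvgr_lt _ lQ'); have := ler_norm (- eQ); rewrite normrN.
    by have := normr_ge0 eQ; lra.
  apply: filterS2 near_pos => t t0 hQ1; have [_ ->] := IQ _ (iQ t t0).
  by rewrite mulrCA -e'E ler_pM2l// ltW.
- have [_ ->] := IQ _ nQ; rewrite -e'E ler_pM2l// -/I.
  by have := normr_ge0 eQ; lra.
Qed.

(** This is the comparison kernel near the diagonal: nonnegative when [phi] is, and a sum of three
    tensors once the square is expanded, so that its weighted integrals converge. *)
Definition energy_kernel (phi u : E -> R) (p : E * E) : R :=
  phi p.1 * phi p.2 * (u p.2 - u p.1) ^+ 2.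

Lemma energy_kernel_limit phi u : test_fun phi -> test_fun u ->
  exists e, form_limit (energy_kernel phi u) (fun=> 0) e.
Proof.
move=> Tp Tu; have Tpu := test_mul _ _ Tp Tu; have Tpuu := test_mul _ _ Tpu Tu.
have L := form_limit_lin (-2) _ _ _ _ _ _ (form_limit_tensor _ _ Tpu Tpu)
  (form_limit_lin 1 _ _ _ _ _ _ (form_limit_tensor _ _ Tp Tpuu)
     (form_limit_tensor _ _ Tpuu Tp)).
eexists; apply: (form_limit_eq _ _ _ _ _ _ L) => //.
- by move=> p; rewrite /tensor /energy_kernel !funME; ring.
- by move=> x; rewrite !funME; ring.
Qed.

(** The standing assumption integrates [(u(y) - u(x)) phi(y)], and the remaining factor
    [phi(x) (u(y) - u(x))] is bounded and continuous. *)
Lemma energy_kernel_integrable phi u : test_fun phi -> test_fun u ->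
  nu.-integrable [set: BEE] (EFin \o energy_kernel phi u).
Proof.
move=> Tp Tu; have [e [cQ _ _ _]] := energy_kernel_limit _ _ Tp Tu.
have [Mp Mp0 pM] := C0_bounded _ Tp.1; have [Mu Mu0 uM] := C0_bounded _ Tu.1.
have cp := test_continuous _ Tp; have cu := test_continuous _ Tu.
have cB : continuous (fun p : E * E => phi p.1 * (u p.2 - u p.1)).
  move=> p; apply: cvgM; first exact: continuous_fst_comp.
  by apply: cvgB; [exact: continuous_snd_comp|exact: continuous_fst_comp].
have BM (p : E * E) : `|phi p.1 * (u p.2 - u p.1)| <= Mp * (Mu + Mu).
  by rewrite normrM ler_pM// (le_trans (ler_normB _ _))// lerD.
have i := jump_integrable u phi _ _ Tu Tp cB BM.
have JI : Jint (fun p => energy_kernel phi u (p.2, p.1))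
    (\int[J]_(p in (~` diagE : set BEE))
      ((u p.2 - u p.1) * phi p.2 * (phi p.1 * (u p.2 - u p.1)))).
  apply: has_integral_ext (has_integral_intro _ _ _ i) => // p _ /=.
  by rewrite /energy_kernel/=; ring.
by have [] := flip_measure_integral J J0 _ _ (borel_continuous _ cQ) JI.
Qed.

(* A kernel vanishing to third order on the diagonal does not see the local
   part of the form. *)
Lemma third_order_jump H h (e r : R) phi u v (C : set (E * E)) (M : R) :
  (forall x, h x = 0) -> form_limit H h e ->
  compact C -> (forall p, ~ C p -> H p = 0) -> (forall p, `|H p| <= M) ->
  test_fun phi -> (forall x, 0 <= phi x) -> test_fun u -> test_fun v ->
  (forall e', 0 < e' -> exists2 d : R, 0 < d & forall p, rho p.1 p.2 < d ->
     H p = 0 \/ [/\ phi p.1 = 1, phi p.2 = 1 &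
       `|H p| <= e' * `|(u p.2 - u p.1) * (v p.2 - v p.1)|]) ->
  Jint (fun p => H (p.2, p.1)) r -> e = - 2 * r.
Proof.
move=> h0 LH cC HC HM Tp p0 Tu Tv small HJ.
have [eu Lu] := energy_kernel_limit _ _ Tp Tu.
have [ev Lv] := energy_kernel_limit _ _ Tp Tv.
have L := form_limit_lin 1 _ _ _ _ _ _ Lu Lv.
have [Qi _] := has_integralD nu _ measurableT _ _ _ _
  (has_integralZ nu _ measurableT 1 _ _
    (has_integral_intro _ _ _ (energy_kernel_integrable _ _ Tp Tu)))
  (has_integral_intro _ _ _ (energy_kernel_integrable _ _ Tp Tv)).
have K0 w p : 0 <= energy_kernel phi w p.
  by rewrite /energy_kernel mulr_ge0 ?sqr_ge0// mulr_ge0.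
have Q0 p : 0 <= 1 * energy_kernel phi u p + energy_kernel phi v p.
  by rewrite mul1r addr_ge0.
apply: (form_limit_jump _ _ _ _ _ _ _ _ _ h0 LH cC HC HM _ L Qi Q0 _ HJ).
  by move=> x; ring.
move=> e' e'0; have [d d0 Hd] := small e' e'0; exists d => // p dp.
have [->|[p1 p2 Hp]] := Hd p dp; first by rewrite normr0 mulr_ge0// ltW.
apply: le_trans Hp _; rewrite ler_pM2l// /energy_kernel p1 p2 !mul1r.
(* The product of the increments is at most the sum of their squares, hence at most the sum of the
   two energy kernels. *)
move: (u p.2 - u p.1) (v p.2 - v p.1) => a b.
have := sqr_ge0 (a + b); have := sqr_ge0 (a - b).
by have := sqr_ge0 a; have := sqr_ge0 b; rewrite ler_norml; lra.
Qed.

(** * The iterated limit near the diagonal *)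

Lemma exhaustion_compact (C : set E) : compact C ->
  \forall l \near \oo, C `<=` Om l.
Proof.
have [_ _ _ _ [_ _ [oOm [inc cov] _ _ _]]] := HS.
move=> /compact_near_coveringP /(_ _ \oo (fun l x => Om l x)) /(_ _); apply => x _.
have [l0 _ Ol0] : (\bigcup_l Om l) x by rewrite cov.
have mono l : (l0 <= l)%N -> Om l0 `<=` Om l.
  elim: l => [|l IH]; first by rewrite leqn0 => /eqP ->.
  rewrite leq_eqVlt ltnS => /orP[/eqP -> //|/IH h]; exact: subset_trans h (inc l).
near=> y l.
have Oy : Om l0 y.
  by near: y; apply: open_nbhs_nbhs; split => //; case: (oOm l0).
have Ll : (l0 <= l)%N by near: l; exists l0.
exact: mono Oy.
Unshelve. all: by end_near.
Qed.

Lemma plateau_uniform phi (C : set E) : continuous phi -> compact C ->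
  (forall x, C x -> \forall y \near x, phi y = 1 :> R) ->
  exists2 d : R, 0 < d & forall x y, C x -> rho x y < d -> phi x = 1 /\ phi y = 1.
Proof.
move=> cphi cC phiC; pose U := [set y | phi y = 1]°.
have oO : open (U `*` U) by apply: open_rectangle; exact: open_interior.
have [x Cx|d d0 Hd] := diag_uniform_nbhs C (U `*` U) cC oO.
  by split; exact: phiC.
by exists d => // x y Cx xy; have [/interior_subset ? /interior_subset ?] := Hd x y Cx xy.
Qed.

(** For large [l] the integrand on [Lambda l] is a global kernel [P] minus its restriction to the
    far set [S l]. The first converges through the form, the second vaguely because [S l] is a
    continuity set; as [l] grows, dominated convergence restores the full jump integral of [P]. *)
Lemma Ehc_formula phi u g (C : set E) (r : R) : test_fun phi -> test_fun u ->
  test_fun g -> compact C -> (forall x, C x -> \forall y \near x, phi y = 1) ->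
  (forall x, ~ C x -> g x = 0) ->
  Jint (fun p => phi p.2 * (u p.1 - u p.2) * g p.1) r ->
  Ehc sig Om vs u g = F g (phi * u) - F (u * g) phi - 2 * r.
Proof.
move=> Tp Tu Tg cC phiC gC HJ.
have [_ _ _ _ [_ _ [oOm _ vs0 vscvg Jbd]]] := HS.
pose P (p : E * E) := phi p.1 * (u p.2 - u p.1) * g p.2.
have Tpu := test_mul _ _ Tp Tu; have Tug := test_mul _ _ Tu Tg.
have LP : form_limit P (fun=> 0) (F (u * g) phi - F g (phi * u)).
  have L := form_limit_lin (-1) _ _ _ _ _ _ (form_limit_tensor _ _ Tpu Tg)
     (form_limit_tensor _ _ Tp Tug).
  apply: (form_limit_eq _ _ _ _ _ _ L).
  - by move=> p; rewrite /tensor /P !funME; ring.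
  - by move=> x; rewrite !funME; ring.
  - by ring.
have [cP iP _ lP] := LP; have mP := borel_continuous _ cP.
have [nP nr] := flip_measure_integral J J0 P r mP HJ.
have [Mp Mp0 pM] := C0_bounded _ Tp.1; have [Mu Mu0 uM] := C0_bounded _ Tu.1.
have [Mg Mg0 gM] := C0_bounded _ Tg.1.
have PM p : `|P p| <= Mp * (Mu + Mu) * Mg.
  rewrite /P !normrM ler_pM ?mulr_ge0// ler_pM// (le_trans (ler_normB _ _))// lerD//.
have P0 p : ~ (supp phi `*` C) p -> P p = 0.
  move=> np; rewrite /P; have [sp|/C0_supp0 ->] := pselect (supp phi p.1); last by rewrite !mul0r.
  by rewrite gC ?mulr0// => Cp; apply: np.
have Pdiag p : rho p.1 p.2 = 0 -> P p = 0.
  by move=> /diagE_rho; rewrite /diagE/= /P => ->; rewrite subrr mulr0 mul0r.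
have cCC : compact (supp phi `*` C) by apply: compact_setX => //; case: Tp => -[].
have clCC : closed (supp phi `*` C) := compact_closed hausdorff_prod cCC.
have [d d0 Hd] := plateau_uniform phi C (test_continuous _ Tp) cC phiC.
pose S l := [set p : E * E | Om l p.1 /\ Om l p.2 /\ vs l <= rho p.1 p.2].
have crho := @continuous_rho R E.
have cl_rho x : closed [set p : E * E | x <= rho p.1 p.2].
  by move/continuous_closedP : crho => /(_ _ (@closed_ge R x)).
have op_Om l : open [set p : E * E | Om l p.1 /\ Om l p.2].
  by case: (oOm l) => oOl _; exact: (open_rectangle _ _ oOl oOl).
have mS l : measurable (S l : set BEE).
  have -> : S l = [set p : E * E | Om l p.1 /\ Om l p.2] `&` [set p | vs l <= rho p.1 p.2].
    by apply/seteqP; split => p /=; rewrite /S/=; tauto.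
  by apply: measurableI; [exact: borel_open|exact: borel_closed].
pose q l (p : E * E) := P p * \1_(S l) p.
have mq l : measurable_fun [set: BEE] (q l : BEE -> R).
  by apply: measurable_funM => //; exact: measurable_indic.
have qP l p : `|q l p| <= `|P p|.
  rewrite /q normrM ler_piMr// indicE; case: (_ \in _); by rewrite ?normr1 ?normr0.
have vague_q l : vague_cvg c sig nu (q l).
  have Sr : closure (S l) `<=` [set p | vs l <= rho p.1 p.2].
    by rewrite [X in _ `<=` X](closure_id _).1//; apply: closureS => p [_ []].
  have vsW (A : set (E * E)) : A `<=` [set p | vs l <= rho p.1 p.2] -> A `<=` ~` diagE.
    move=> Ar p /Ar /= vp /diagE_rho p0; move: vp; rewrite p0.
    by have [v0 _] := vs0 l; move: v0; lra.
  (* Only the boundary of [S l] produces discontinuities, and only where [P] can be nonzero; this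
     part of the boundary is compact and avoids the diagonal. *)
  pose Z := (supp phi `*` C) `&` (closure (S l) `\` (S l)°).
  have clZ : closed (closure (S l) `\` (S l)°).
    by apply: closedI; [exact: closed_closure|apply: open_closedC; exact: open_interior].
  apply: (vague_cvg_ae_continuous c sig nu c_ge0 hausdorff_prod _ _ offdiag_bump_algebra
    offdiag_vague _ ((supp phi `*` C) `&` [set p | vs l <= rho p.1 p.2]) Z
    (Mp * (Mu + Mu) * Mg)).
  - exact: mq.
  - exact: compact_closedI.
  - by apply: vsW => p [].
  - by move=> p; apply: le_trans (qP l p) (PM p).
  - move=> p np; rewrite /q indicE; have [Sp|nSp] := pselect (S l p); last by rewrite memNset// mulr0.
    by rewrite P0 ?mul0r// => Cp; apply: np; split => //; case: Sp => _ [].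
  - exact: compact_closedI.
  - by apply: vsW => p [_ [/Sr]].
  - apply/eqP; rewrite eq_le measure_ge0 andbT -(Jbd l) -/(S l).
    have -> : nu Z = J (@flip_pair E @^-1` Z) by [].
    (* [S l] is symmetric, so the exchange of coordinates preserves its boundary and
       [J]-negligibility passes to [nu]. *)
    have flipS p : S l p -> S l (flip_pair p).
      by move=> [? [? h]]; split => //; split => //=; rewrite /rho metric_sym.
    apply: le_measure.
    + rewrite inE -[X in measurable X]setTI; apply: measurable_flip => //.
      by apply: borel_closed; apply: closedI.
    + by rewrite inE; exact: borel_closed.
    + move=> p [_ [clp nintp]]; split.
        move=> B nB.
        have [z [Sz Bz]] := clp _ (@continuous_flip R E (flip_pair p) _ nB).
        by exists (flip_pair z); split => //; exact: flipS.
      move=> intp; apply: nintp.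
      have nS : nbhs (flip_pair (flip_pair p)) (S l) by case: p intp {clp} => x y.
      have nF : nbhs (flip_pair p) (@flip_pair E @^-1` S l).
        exact: (@continuous_flip R E (flip_pair p) _ nS).
      by apply: filterS nF => -[x y] /flipS.
  - move=> p nZp.
    have [Cp|nCp] := pselect ((supp phi `*` C) p); last first.
      have E0 : \forall z \near p, 0 = q l z.
        have : nbhs p (~` (supp phi `*` C)).
          by apply: open_nbhs_nbhs; split => //; exact: closed_openC.
        by apply: filterS => z nz; rewrite /q P0// mul0r.
      by apply: (near_eq_continuous _ _ _ E0); exact: cvg_cst.
    have [clp|nclp] := pselect (closure (S l) p); last first.
      have E0 : \forall z \near p, 0 = q l z.
        have : nbhs p (~` closure (S l)).
          by apply: open_nbhs_nbhs; split => //; apply: closed_openC; exact: closed_closure.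
        apply: filterS => z nz; rewrite /q indicE memNset ?mulr0// => Sz.
        by apply: nz; exact: subset_closure.
      by apply: (near_eq_continuous _ _ _ E0); exact: cvg_cst.
    have intp : (S l)° p by apply: contrapT => nip; apply: nZp.
    have E1 : \forall z \near p, P z = q l z.
      by apply: filterS intp => z Sz; rewrite /q indicE mem_set// mulr1.
    by apply: (near_eq_continuous _ _ _ E1); exact: cP.
have inner_lim : \forall l \near \oo,
   lim ((fun t : R => t * \int[sig t]_(p in (Lambda Om vs l : set BEE))
                   ((u p.2 - u p.1) * g p.2)) @ +oo%R) =
   F g (phi * u) - F (u * g) phi - 2 * \int[nu]_(p in [set: BEE]) q l p.
  near=> l.
  have COm : C `<=` Om l by near: l; exact: exhaustion_compact.
  have sOm : supp phi `<=` Om l by near: l; apply: exhaustion_compact; case: Tp => -[].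
  have vsd : vs l < d by near: l; exact: (cvgr_lt _ vscvg).
  apply: cvg_lim; first exact: norm_hausdorff.
  have [_ iq _ lq] := vague_q l.
  have -> : F g (phi * u) - F (u * g) phi - 2 * \int[nu]_(p in [set: BEE]) q l p =
     (-1) * (F (u * g) phi - F g (phi * u)) + (-2) * \int[nu]_(p in [set: BEE]) q l p by ring.
  apply: cvg_trans (cvgD (cvgMl_tmp (a := -1) lP) (cvgMl_tmp (a := -2) lq)).
  apply: near_eq_cvg; near=> t.
  have t0 : 0 < t by near: t.
  have [_ I2] := has_integralB (sig t) _ measurableT _ _ _ _
    (has_integral_intro _ _ _ (iP t t0)) (has_integral_intro _ _ _ (iq t t0)).
  have -> : \int[sig t]_(p in (Lambda Om vs l : set BEE)) ((u p.2 - u p.1) * g p.2) =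
     \int[sig t]_(p in [set: BEE]) (P p - q l p).
    (* On [Lambda l] the indicator is 0, and [phi] is 1 wherever the second point lies in [C]. Off
       [Lambda l], either [P] and [q l] agree on [S l], or [P] vanishes. *)
    rewrite Rintegral_mkcond; apply: eq_Rintegral => p _; rewrite /patch /q.
    case: ifPn; rewrite ?inE ?notin_setE => Lp.
      have [Op1 [Op2 rp]] := Lp.
      rewrite indicE memNset ?mulr0 ?subr0; last by move=> [_ [_]]; rewrite leNgt rp.
      rewrite /P; have [Cp|/gC ->] := pselect (C p.2); last by rewrite !mulr0.
      have [|_ ->] := Hd p.2 p.1 Cp; last by rewrite mul1r.
      by rewrite /rho metric_sym; exact: lt_trans vsd.
    rewrite indicE; have [Sp|nSp] := pselect (S l p); first by rewrite mem_set// mulr1 subrr.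
    rewrite memNset// mulr0 subr0 P0// => -[sp Cp]; apply: Lp.
    split; [exact: sOm|split; first exact: COm].
    by rewrite ltNge; apply/negP => vp; apply: nSp; split; [exact: sOm|split => //; exact: COm].
  rewrite I2.
  have -> : \int[m]_(x in [set: BE]) (0 : R) = 0 by rewrite Rintegral_cst// mul0r.
  have arith (a b : R) : -1 * (t * (0 - a)) + -2 * (t / 2 * b) = t * (a - b) by field.
  exact: arith.
rewrite /Ehc; apply: cvg_lim; first exact: norm_hausdorff.
have [_ lq] : nu.-integrable [set: BEE] (EFin \o P) /\
    \int[nu]_(p in [set: BEE]) q l p @[l --> \oo] --> \int[nu]_(p in [set: BEE]) P p.
  apply: (@Rintegral_dominated_cvg _ _ _ nu _ measurableT q P (fun p => `|P p|)) => //.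
  - exact: integrable_abse nP.
  (* On the diagonal both kernels are 0; any other point lies in [S l] for all large [l]. *)
  - move=> p _; have [p0|pN] := eqVneq (rho p.1 p.2) 0.
      by apply: cvg_near_cst; apply: nearW => l; rewrite /q Pdiag// mul0r.
    have pp : 0 < rho p.1 p.2 by rewrite lt_def pN /rho mdist_ge0.
    apply: cvg_near_cst; near=> l; rewrite /q indicE mem_set ?mulr1//; split; [|split].
    + near: l; have := exhaustion_compact [set p.1] (@compact_set1 _ _).
      by apply: filterS => l; exact.
    + near: l; have := exhaustion_compact [set p.2] (@compact_set1 _ _).
      by apply: filterS => l; exact.
    + by near: l; exact: (cvgr_le _ vscvg).
rewrite nr in lq.
apply: cvg_trans (cvgB (cvg_cst (F g (phi * u) - F (u * g) phi))
  (cvgMl_tmp (a := 2) lq)).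
by apply: near_eq_cvg; apply: filterS inner_lim => l ->.
Unshelve. all: by end_near.
Qed.

(** * The local form and its Leibniz rules *)

Definition jump_form (a b : E -> R) : R :=
  \int[J]_(p in (~` diagE : set BEE)) (2 * (a p.2 - a p.1) * b p.2).

(** The killing part is kept, unlike in [Ec]: by [local_form_plateau] it is itself a value of this
    functional, so each identity becomes the vanishing of a combination of such values. *)
Definition local_form (a b : E -> R) : R := F a b - jump_form a b.

Lemma jump_form_integral a b : test_fun a -> test_fun b ->
  Jint (fun p => 2 * (a p.2 - a p.1) * b p.2) (jump_form a b).
Proof.
move=> [Ca Da] [Cb Db]; have [_ i] := HSA a b Ca Da Cb Db; split => //.
have [+ _] := has_integralZ _ _ mW 2 _ _
  (has_integral_intro _ _ (fun p : BEE => (a p.2 - a p.1) * b p.2) i).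
by apply: eq_integrable => // p _ /=; rewrite mulrA.
Qed.

(** [s] is the jump part of [e]: for [tensor a b] its integrand is [2 (b(y) - b(x)) a(y)]. The
    compact set and the bound accompany the kernel because the vague convergence argument needs
    them. *)
Definition local_limit (H : E * E -> R) (h : E -> R) (y : R) : Prop :=
  exists e s C M,
    [/\ form_limit H h e, Jint (fun p => 2 * (h p.2 - H (p.2, p.1))) s,
        compact C /\ (forall p, ~ C p -> H p = 0), (forall p, `|H p| <= M) &
        y = e - s].

Lemma local_limit_tensor a b : test_fun a -> test_fun b ->
  local_limit (tensor a b) (a * b) (local_form b a).
Proof.
move=> Ta Tb; exists (F b a), (jump_form b a), (supp a `*` supp b).
have [Ma Ma0 aM] := C0_bounded _ Ta.1; have [Mb Mb0 bM] := C0_bounded _ Tb.1.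
exists (Ma * Mb); split => //.
- exact: form_limit_tensor.
- apply: has_integral_ext (jump_form_integral _ _ Tb Ta) => // p _.
  by rewrite /tensor !funME/=; ring.
- split; first by apply: compact_setX; [case: Ta => -[]|case: Tb => -[]].
  move=> p np; rewrite /tensor; have [ap|/C0_supp0 ->] := pselect (supp a p.1); last by rewrite mul0r.
  by rewrite (C0_supp0 b) ?mulr0// => bp; apply: np.
- by move=> p; rewrite /tensor normrM ler_pM.
Qed.

Lemma local_limit_lin (k : R) H1 H2 h1 h2 (y1 y2 : R) :
  local_limit H1 h1 y1 -> local_limit H2 h2 y2 ->
  local_limit (fun p => k * H1 p + H2 p) (fun x => k * h1 x + h2 x) (k * y1 + y2).
Proof.
move=> [e1 [s1 [C1 [M1 [L1 J1 [c1 z1] b1 ->]]]]] [e2 [s2 [C2 [M2 [L2 J2 [c2 z2] b2 ->]]]]].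
exists (k * e1 + e2), (k * s1 + s2), (C1 `|` C2), (`|k| * M1 + M2); split.
- exact: form_limit_lin.
- apply: has_integral_ext (has_integralD _ _ mW _ _ _ _ (has_integralZ _ _ mW k _ _ J1) J2) => //.
  by move=> p _; ring.
- split; first exact: compactU.
  move=> p np; rewrite z1; last by move=> ?; apply: np; left.
  by rewrite z2 ?mulr0 ?addr0// => ?; apply: np; right.
- by move=> p; rewrite (le_trans (ler_normD _ _))// lerD// normrM ler_wpM2l.
- by ring.
Qed.

(** When [h = 0], the jump part is [- 2] times the integral of the flipped kernel, which is also the
    value of [e] given by [third_order_jump]. *)
Lemma local_limit_third_order H0 H h (y : R) phi u v :
  local_limit H0 h y -> H0 =1 H -> (forall x, h x = 0) ->
  test_fun phi -> (forall x, 0 <= phi x) -> test_fun u -> test_fun v ->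
  (forall e', 0 < e' -> exists2 d : R, 0 < d & forall p, rho p.1 p.2 < d ->
     H p = 0 \/ [/\ phi p.1 = 1, phi p.2 = 1 &
       `|H p| <= e' * `|(u p.2 - u p.1) * (v p.2 - v p.1)|]) ->
  y = 0.
Proof.
move=> + /funext E0 h0; rewrite E0.
move=> [e [s [C [M [L HJ [cC zC] bM ->]]]]] Tp p0 Tu Tv small.
have HJ' : Jint (fun p => H (p.2, p.1)) (- 2^-1 * s).
  by apply: has_integral_ext (has_integralZ _ _ mW (- 2^-1) _ _ HJ) => // p _; rewrite h0; field.
have -> := third_order_jump _ _ _ _ _ _ _ _ _ h0 L cC zC bM Tp p0 Tu Tv small HJ'.
by field.
Qed.

Lemma Ehc_local_form phi u g (C : set E) : test_fun phi -> test_fun u ->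
  test_fun g -> compact C -> (forall x, C x -> \forall y \near x, phi y = 1) ->
  (forall x, ~ C x -> g x = 0) ->
  Ehc sig Om vs u g = local_form g (phi * u) - local_form (u * g) phi.
Proof.
move=> Tp Tu Tg cC phiC gC.
have Tpu := test_mul _ _ Tp Tu; have Tug := test_mul _ _ Tu Tg.
have HJ := has_integralZ _ _ mW (2^-1) _ _ (has_integralB _ _ mW _ _ _ _
  (jump_form_integral _ _ Tg Tpu) (jump_form_integral _ _ Tug Tp)).
rewrite (Ehc_formula phi u g C (2^-1 * (jump_form g (phi * u) - jump_form (u * g) phi)))//.
  by rewrite /local_form; field.
by apply: has_integral_ext HJ => // p _; rewrite !funME; field.
Qed.

Lemma plateau_exists (C : set E) : compact C -> exists phi : E -> R,
  [/\ test_fun phi, (forall x, 0 <= phi x) &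
      forall x, C x -> \forall y \near x, phi y = 1].
Proof.
move=> cC.
have [phi [Tp p01 pC _]] := bump_compact _ _ _ _ test_bump_algebra cC openT
  (@subsetT _ _) (@subset_refl _ _).
by exists phi; split => // x; have /andP[] := p01 x.
Qed.

(** [phi] is constant near the support of [f], so the formula defining [J] and [K] applies and its
    jump part cancels. *)
Lemma local_form_plateau phi f : test_fun phi -> test_fun f ->
  (forall x, supp f x -> \forall y \near x, phi y = 1) ->
  local_form phi f = \int[K]_(x in [set: BE]) (f x).
Proof.
move=> Tp Tf pf; have [_ [_ FJK]] := HJK; have [Cp Dp] := Tp; have [Cf Df] := Tf.
rewrite /local_form (FJK phi f Cp Dp Cf Df); last first.
  exists ([set y | phi y = 1]°), 1; split; first exact: open_interior.
  by split; [exact: pf|move=> x /interior_subset].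
rewrite -/(jump_form phi f) addrC addKr; apply: eq_Rintegral => x _.
have [/pf/nbhs_singleton ->|/C0_supp0 ->] := pselect (supp f x); last by rewrite mulr0.
by rewrite mul1r.
Qed.

Lemma Ec_local_form a b : Ec F J K a b =
  local_form a b - \int[K]_(x in [set: BE]) (a x * b x).
Proof. by []. Qed.

(** With [w f] in place of [g] this is (iii) up to a factor 2. Once [Ehc] and the killing integrals
    are written as local forms, the kernel of the difference is [(g(x) - g(y)) (u(y) - u(x)) (v(y) -
    v(x))] near the diagonal, and [g] is uniformly continuous. *)
Lemma Ehc_leibniz u v g : test_fun u -> test_fun v -> test_fun g ->
  Ec F J K (u * v) g - Ec F J K u (v * g) - Ec F J K v (u * g) =
  Ehc sig Om vs (u * v) g - Ehc sig Om vs u (v * g) - Ehc sig Om vs v (u * g).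
Proof.
move=> Tu Tv Tg; have [Cg Dg] := Tg; have [cg sg] := Cg.
have [phi [Tp p0 pC]] := plateau_exists _ sg.
have g0 x : ~ supp g x -> g x = 0 by exact: C0_supp0.
have Tuv := test_mul _ _ Tu Tv.
have Tvg := test_mul _ _ Tv Tg; have Tug := test_mul _ _ Tu Tg.
have Tuvg := test_mul _ _ Tu Tvg.
have Tpuv := test_mul _ _ Tp Tuv; have Tpu := test_mul _ _ Tp Tu.
have Tpv := test_mul _ _ Tp Tv.
rewrite (Ehc_local_form phi (u * v) g (supp g))//.
rewrite (Ehc_local_form phi u (v * g) (supp g))//; last first.
  by move=> x /g0 gx; rewrite funME gx mulr0.
rewrite (Ehc_local_form phi v (u * g) (supp g))//; last first.
  by move=> x /g0 gx; rewrite funME gx mulr0.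
have E1 : u * v * g = u * (v * g) by rewrite mulrA.
have E2 : v * (u * g) = u * (v * g) by rewrite mulrCA.
rewrite E1 E2 !Ec_local_form.
have k1 : \int[K]_(x in [set: BE]) ((u * v) x * g x) = local_form phi (u * (v * g)).
  rewrite local_form_plateau//; first by apply: eq_Rintegral => x _; rewrite !funME mulrA.
  move=> x; rewrite -E1 mulrC => /supp_mull; exact: pC.
have k2 : \int[K]_(x in [set: BE]) (u x * (v * g) x) = \int[K]_(x in [set: BE]) ((u * v) x * g x).
  by apply: eq_Rintegral => x _; rewrite !funME mulrA.
have k3 : \int[K]_(x in [set: BE]) (v x * (u * g) x) = \int[K]_(x in [set: BE]) ((u * v) x * g x).
  by apply: eq_Rintegral => x _; rewrite !funME mulrCA mulrA.
rewrite k3 k2 k1.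
have T := local_limit_tensor.
have L := local_limit_lin 1 _ _ _ _ _ _ (T _ _ Tg Tuv)
  (local_limit_lin (-1) _ _ _ _ _ _ (T _ _ Tvg Tu)
  (local_limit_lin (-1) _ _ _ _ _ _ (T _ _ Tug Tv)
  (local_limit_lin 1 _ _ _ _ _ _ (T _ _ Tuvg Tp)
  (local_limit_lin (-1) _ _ _ _ _ _ (T _ _ Tpuv Tg)
  (local_limit_lin (-1) _ _ _ _ _ _ (T _ _ Tp Tuvg)
  (local_limit_lin 1 _ _ _ _ _ _ (T _ _ Tpu Tvg) (T _ _ Tpv Tug))))))).
have phig x : phi x * g x = g x.
  have [/pC/nbhs_singleton ->|/g0 ->] := pselect (supp g x); by rewrite ?mul1r ?mulr0.
(* The term with [1 - phi] carries the killing part. For a close pair meeting [supp g] it vanishes,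
   since [phi] is 1 at both points; for all other pairs [H] is 0. *)
pose H (p : E * E) := g p.1 * ((u p.2 - u p.1) * (v p.2 - v p.1) - u p.1 * v p.1 * (1 - phi p.2))
  - phi p.1 * g p.2 * ((u p.2 - u p.1) * (v p.2 - v p.1)).
have : 1 * local_form (u * v) g + (-1 * local_form u (v * g) + (-1 * local_form v (u * g) +
    (1 * local_form phi (u * (v * g)) + (-1 * local_form g (phi * (u * v)) +
    (-1 * local_form (u * (v * g)) phi + (1 * local_form (v * g) (phi * u) +
     local_form (u * g) (phi * v))))))) = 0.
  apply: (local_limit_third_order _ H _ _ phi u v L) => //.
  - by move=> p; rewrite /tensor /H !funME; ring.
  - move=> x; rewrite !funME; transitivity (u x * v x * (phi x * g x - g x)); first by ring.
    by rewrite phig subrr mulr0.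
  move=> e' e'0.
  have [d1 d10 H1] := plateau_uniform _ _ (test_continuous _ Tp) sg pC.
  have [d2 d20 H2] := C0_uniform _ _ Cg e'0.
  exists (Num.min d1 d2); first by rewrite lt_min d10.
  move=> p; rewrite lt_min => /andP[pd1 pd2].
  have near1 : phi p.1 = 1 -> phi p.2 = 1 -> [/\ phi p.1 = 1, phi p.2 = 1 &
       `|H p| <= e' * `|(u p.2 - u p.1) * (v p.2 - v p.1)|].
    move=> q1 q2; split => //; rewrite /H q1 q2.
    have -> : g p.1 * ((u p.2 - u p.1) * (v p.2 - v p.1) - u p.1 * v p.1 * (1 - 1))
      - 1 * g p.2 * ((u p.2 - u p.1) * (v p.2 - v p.1)) =
      (g p.1 - g p.2) * ((u p.2 - u p.1) * (v p.2 - v p.1)) by ring.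
    by rewrite normrM ler_wpM2r// H2.
  have [s1|/g0 n1] := pselect (supp g p.1).
    by right; have [? ?] := H1 p.1 p.2 s1 pd1; exact: near1.
  have [s2|/g0 n2] := pselect (supp g p.2).
    by right; have [|? ?] := H1 p.2 p.1 s2; [rewrite /rho metric_sym|exact: near1].
  by left; rewrite /H n1 n2 mulr0 !mul0r subrr.
by lra.
Qed.

(** The kernel of the difference is, near the diagonal, [- f(x)] times the product of the increments
    of [u], [v] and [w]. The last increment is uniformly small and the other two are controlled by
    energy kernels. *)
Lemma mu_c_leibniz u v w f : test_fun u -> test_fun v -> test_fun w -> test_fun f ->
  Ec F J K (u * v) (w * f) + Ec F J K w (u * v * f) - Ec F J K (u * v * w) f =
  (Ec F J K v (w * (u * f)) + Ec F J K w (v * (u * f)) - Ec F J K (v * w) (u * f)) +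
  (Ec F J K u (w * (v * f)) + Ec F J K w (u * (v * f)) - Ec F J K (u * w) (v * f)).
Proof.
move=> Tu Tv Tw Tf; have [Cf Df] := Tf; have [cf sf] := Cf.
have [phi [Tp p0 pC]] := plateau_exists _ sf.
have f0 x : ~ supp f x -> f x = 0 by exact: C0_supp0.
have Tuv := test_mul _ _ Tu Tv; have Tvw := test_mul _ _ Tv Tw.
have Tuw := test_mul _ _ Tu Tw; have Tuvw := test_mul _ _ Tuv Tw.
have Tuf := test_mul _ _ Tu Tf; have Tvf := test_mul _ _ Tv Tf.
have Twf := test_mul _ _ Tw Tf; have Tuvf := test_mul _ _ Tu Tvf.
have Twuf := test_mul _ _ Tw Tuf; have Twvf := test_mul _ _ Tw Tvf.
have Tuvwf := test_mul _ _ Tuvw Tf.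
have E1 : u * v * f = u * (v * f) by rewrite mulrA.
have E2 : v * (u * f) = u * (v * f) by rewrite mulrCA.
rewrite E1 E2 !Ec_local_form.
set k := local_form phi (u * v * w * f).
(* All killing integrals have the same integrand, so they reduce to one value of [local_form]. *)
have kE (q : E -> R) : (forall x, q x = u x * v x * w x * f x) ->
    \int[K]_(x in [set: BE]) q x = k.
  move=> qE; rewrite /k local_form_plateau//; first exact: eq_Rintegral.
  by move=> x; rewrite mulrC => /supp_mull; exact: pC.
rewrite !kE; try by move=> x; rewrite !funME; ring.
have T := local_limit_tensor.
have L := local_limit_lin 1 _ _ _ _ _ _ (T _ _ Twf Tuv)
  (local_limit_lin (-1) _ _ _ _ _ _ (T _ _ Tf Tuvw)
  (local_limit_lin (-1) _ _ _ _ _ _ (T _ _ Twuf Tv)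
  (local_limit_lin (-1) _ _ _ _ _ _ (T _ _ Twvf Tu)
  (local_limit_lin 1 _ _ _ _ _ _ (T _ _ Tuf Tvw)
  (local_limit_lin 1 _ _ _ _ _ _ (T _ _ Tvf Tuw)
  (local_limit_lin (-1) _ _ _ _ _ _ (T _ _ Tuvf Tw) (T _ _ Tuvwf Tp))))))).
have phif x : f x * phi x = f x.
  have [/pC/nbhs_singleton ->|/f0 ->] := pselect (supp f x); by rewrite ?mulr1 ?mul0r.
pose H (p : E * E) := - f p.1 *
  ((u p.2 - u p.1) * (v p.2 - v p.1) * (w p.2 - w p.1) + u p.1 * v p.1 * w p.1 * (1 - phi p.2)).
have [Mf Mf0 fM] := C0_bounded _ Cf.
have : 1 * local_form (u * v) (w * f) + (-1 * local_form (u * v * w) f +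
    (-1 * local_form v (w * (u * f)) + (-1 * local_form u (w * (v * f)) +
    (1 * local_form (v * w) (u * f) + (1 * local_form (u * w) (v * f) +
    (-1 * local_form w (u * (v * f)) + k)))))) = 0.
  apply: (local_limit_third_order _ H _ _ phi u v L) => //.
  - by move=> p; rewrite /tensor /H !funME; ring.
  - move=> x; rewrite !funME.
    transitivity (u x * v x * w x * (f x * phi x - f x)); first by ring.
    by rewrite phif subrr mulr0.
  move=> e' e'0.
  have [d1 d10 H1] := plateau_uniform _ _ (test_continuous _ Tp) sf pC.
  (* [Mf] may be 0; the added 1 makes [e' / (Mf + 1)] a legitimate modulus for [w]. *)
  have Mf1 : 0 < Mf + 1 by rewrite ltr_wpDl.
  have [d2 d20 H2] := C0_uniform _ _ Tw.1 (divr_gt0 e'0 Mf1).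
  exists (Num.min d1 d2); first by rewrite lt_min d10.
  move=> p; rewrite lt_min => /andP[pd1 pd2].
  have [s1|/f0 n1] := pselect (supp f p.1); last by left; rewrite /H n1 oppr0 mul0r.
  right; have [q1 q2] := H1 p.1 p.2 s1 pd1; split => //; rewrite /H q2.
  have -> : - f p.1 * ((u p.2 - u p.1) * (v p.2 - v p.1) * (w p.2 - w p.1) + u p.1 * v p.1 * w p.1 * (1 - 1)) =
     f p.1 * (w p.1 - w p.2) * ((u p.2 - u p.1) * (v p.2 - v p.1)) by ring.
  rewrite normrM ler_wpM2r// normrM.
  have -> : e' = (Mf + 1) * (e' / (Mf + 1)) by field; rewrite gt_eqF.
  by rewrite ler_pM// ?H2// (le_trans (fM _))// lerDl.
by lra.
Qed.

End SettingConvergence.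

(** * From the Leibniz rules to measures and functionals *)

Theorem theorem3p3 (R : realType) (E : pmetricType R)
  (m : {measure set borel E -> \bar R}) (D : set (E -> R))
  (F : (E -> R) -> (E -> R) -> R) (Gh : R -> (E -> R) -> E -> R)
  (J : {measure set borel (E * E)%type -> \bar R})
  (K : {measure set borel E -> \bar R})
  (sig : R -> {measure set borel (E * E)%type -> \bar R})
  (Om : nat -> set E) (vs : nat -> R) :
  setting m D F Gh J K sig Om vs ->
  forall u v w f : E -> R,
    C0 u -> D u -> C0 v -> D v -> C0 w -> D w -> C0 f -> D f ->
    (* (i) d mu^c_<uv,w> = u d mu^c_<v,w> + v d mu^c_<u,w> *)
    (forall mp1 mn1 mp2 mn2 mp3 mn3 : {measure set borel E -> \bar R},
       is_mu_c D F J K (u * v) w mp1 mn1 ->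
       is_mu_c D F J K v w mp2 mn2 ->
       is_mu_c D F J K u w mp3 mn3 ->
       forall A : set E, measurable (A : set (borel E)) ->
         compact (closure A) ->
         sint mp1 mn1 A (fun=> 1) = sint mp2 mn2 A u + sint mp3 mn3 A v) /\
    (* (ii) <L(u,vw),f> = <L(u,v),wf> *)
    Lpair F J K sig Om vs u (v * w) f = Lpair F J K sig Om vs u v (w * f) /\
    (* (iii) <L(uv,w),f> = <L(u,w),vf> + <L(v,w),uf> *)
    Lpair F J K sig Om vs (u * v) w f =
      Lpair F J K sig Om vs u w (v * f) + Lpair F J K sig Om vs v w (u * f).
Proof.
move=> HS u v w f Cu Du Cv Dv Cw Dw Cf Df.
have Tu : test_fun D u by split.
have Tv : test_fun D v by split.
have Tw : test_fun D w by split.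
have Tf : test_fun D f by split.
have Tmul a b := test_mul _ _ _ _ _ _ _ _ _ HS a b.
split; last first.
  (* In (ii) both sides involve the same function, by associativity of the product. *)
  split; first by rewrite /Lpair mulrA.
  have := Ehc_leibniz _ _ _ _ _ _ _ _ _ HS u v _ Tu Tv (Tmul w f Tw Tf).
  have arith (a b c a' b' c' : R) : a - b - c = a' - b' - c' ->
      (a - a') / 2 = (b - b') / 2 + (c - c') / 2 by lra.
  by rewrite /Lpair (mulrCA w v) (mulrCA w u); exact: arith.
move=> mp1 mn1 mp2 mn2 mp3 mn3 [rp1 [rn1 I1]] [rp2 [rn2 I2]] [rp3 [rn3 I3]] A mA cA.
have [Mu Mu0 uM] := C0_bounded _ Cu; have [Mv Mv0 vM] := C0_bounded _ Cv.
pose L (mu : {measure set borel E -> \bar R}) (a q : E -> R) : R :=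
  \int[mu]_(x in [set: borel E]) (q x * a x).
have LA mu a : L mu a (\1_A) = \int[mu]_(x in (A : set (borel E))) a x.
  rewrite [RHS]Rintegral_mkcond; apply: eq_Rintegral => x _.
  by rewrite /patch indicE; case: (_ \in _); rewrite ?mul1r ?mul0r.
have tame1 mu : radonE mu -> tame_functional (L mu (fun=> 1)).
  move=> rmu; apply: (@tame_functional_weighted _ _ mu _ 1) => //.
    by move=> x; exact: cvg_cst.
  by move=> x; rewrite normr1.
have tamew mu a M : radonE mu -> C0 a -> (forall x, `|a x| <= M) ->
    tame_functional (L mu a).
  by move=> rmu [ca _] aM; exact: (@tame_functional_weighted _ _ mu _ M).
(* The difference of the two sides of (i), as a functional of the test function; it remains to see
   that it vanishes on the domain. *)
pose LL q := (L mp1 (fun=> 1) q - L mn1 (fun=> 1) q) -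
  (L mp2 u q - L mn2 u q) - (L mp3 v q - L mn3 v q).
suff : LL (\1_A) = 0.
  by rewrite /LL !LA => /subr0_eq LLA; apply/eqP; rewrite [eqbRHS]addrC -subr_eq; apply/eqP.
have LLtame : tame_functional LL.
  apply: tame_functionalB; first apply: tame_functionalB.
  - by apply: tame_functionalB; exact: tame1.
  - by apply: tame_functionalB; exact: (tamew _ _ Mu).
  - by apply: tame_functionalB; exact: (tamew _ _ Mv).
apply: (tame_functional_eq0 (test_fun D) LL
  (test_bump_algebra _ _ _ _ _ _ _ _ _ HS)) => // [g []//|g Tg].
(* The weights are absorbed into the test functions [u g] and [v g], for which the identities
   defining the measures are available. *)
have [Cg Dg] := Tg; have [Cug Dug] := Tmul u g Tu Tg; have [Cvg Dvg] := Tmul v g Tv Tg.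
have LE mu a : L mu a g = \int[mu]_(x in [set: borel E]) (a * g) x.
  by apply: eq_Rintegral => x _; rewrite funME mulrC.
have L1 mu : L mu (fun=> 1) g = \int[mu]_(x in [set: borel E]) g x.
  by apply: eq_Rintegral => x _; rewrite mulr1.
rewrite /LL !L1 !LE (I1 g Cg Dg) (I2 _ Cug Dug) (I3 _ Cvg Dvg).
by rewrite (mu_c_leibniz _ _ _ _ _ _ _ _ _ HS u v w g)// -addrA -opprD subrr.
Qed.
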